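(* Let $L = L(n) := \exp\left(\sqrt{\log n \log\log n}\right)$. Algorithms A and B (described in the context) may be combined to tabulate $M(n)$, that is, there is an algorithm obtained by combining Algorithms A and B which, on input $n$, outputs $M(k)$ for all integers $1 \le k \le n$, in time $$O\left(n^2 / L^{1/\sqrt{2} + o(1)}\right) \quad \text{as } n \to \infty.$$
   Context: For a positive integer $n$, $M(n) := |\{ij : 1 \le i,j \le n\}|$ is the number of distinct entries in the $n\times n$ multiplication table. ''Tabulating $M(n)$'' means computing $M(k)$ for all integers $k \in [1,n]$. Let $\delta(n)$ denote the number of elements of $\{mn : 1 \le m \le n\}$ that appear in the $(n-1)\times(n-1)$ multiplication table, i.e. that can be written as $ab$ with $1 \le a,b \le n-1$. Thus $M(n) = M(n-1) + (n - \delta(n))$, with $M(0)=0$. Model of computation: a standard random access machine with infinite direct-access memory, addressable at the bit level or at the word level, with word size $\Theta(\log n)$ bits for input $n$. Arithmetic operations, memory accesses and other basic operations take unit time. Divisor list: for a positive integer $n$, let $1 = d_0 < d_1 < \cdots < d_{\ell-1}$ be all divisors of $n$ in $[1,\sqrt n]$. The divisor list of $n$ is $D = [[d_0, n/d_0], \ldots, [d_{\ell-1}, n/d_{\ell-1}]]$, and $D[k][0] = d_k$, $D[k][1] = n/d_k$. Algorithm A (computing $\delta(n)$). Input: the divisor list $D$ of $n$. Set $k = 0$ and initialize a bit vector $A$ of length $n$ to $0$. For $i = 1, 2, \ldots$ while $i < D[\ell-1][0]$: if $i = D[k][0]$ then increment $k$ by 1; then for every integer $j$ with $i \le j < D[k][1]$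 set $A[ij] = 1$. Return the Hamming weight of $A$. Algorithm B (computing $\delta(mq)$ given $\delta(mp)$ for primes $p,q$ with $m < p < q$). Input: a bit vector $A$ of length $mq$ with Hamming weight $w$ containing the products from computing $\delta(mp)$ (the set bits are those recorded by Algorithm A run for $mp$), and the divisor lists $D_p$ and $D_q$ of $mp$ and $mq$, both of length $\ell$. Set $k=0$. For $i = 1,2,\ldots$ while $i < D_p[\ell-1][0]$: if $i = D_p[k][0]$ then increment $k$ by 1; then for every integer $j$ with $D_p[k][1] \le j < D_q[k][1]$, if $A[ij] = 0$ then set $A[ij] = 1$ and increment $w$ by 1. Return $w$.
   Formalization: Algorithm B is used for all primes p < q not dividing m, with lists [d, mp/d], [d, mq/d] over all divisors d of m (the divisor lists when m < p), instead of only for m < p < q; under m < p < q the bound fails, since even k with no prime factor above √k force order n² steps. *)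

(* Defs.v *)
From HB Require Import structures.
From mathcomp Require Import all_boot all_order all_algebra.
From mathcomp Require Import all_classical all_reals all_analysis.

Set Implicit Arguments.
Unset Strict Implicit.
Unset Printing Implicit Defensive.

Import Order.TTheory GRing.Theory Num.Theory.
Import numFieldNormedType.Exports.

(** * The multiplication table *)

Definition mult_table (n : nat) : seq nat :=
  undup [seq i * j | i <- iota 1 n, j <- iota 1 n].

Definition M (n : nat) : nat := size (mult_table n).

(* For n >= 1 the multiples m * n, 1 <= m <= n, are pairwise distinct, so that
   counting the m is counting the elements. *)
Definition delta (n : nat) : nat :=
  count (fun m => m * n \in mult_table n.-1) (iota 1 n).

Definition divisor_list (n : nat) : seq (nat * nat) :=
  [seq (d, n %/ d) | d <- divisors n & d ^ 2 <= n].

(* The divisor list of m * p, for a prime p not dividing m, organised by the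
   divisors of m: each unordered pair of complementary divisors of m * p has
   exactly one member dividing m. For m < p this is the divisor list of m * p,
   see [divisor_list_mulp] below. *)
Definition cofactor_list (m p : nat) : seq (nat * nat) :=
  [seq (d, (m * p) %/ d) | d <- divisors m].

Lemma divisor_list_mulp (m p : nat) :
  0 < m -> prime p -> m < p -> divisor_list (m * p) = cofactor_list m p.
Proof.
move=> m0 pp mp; rewrite /divisor_list /cofactor_list; congr map.
have p0 := prime_gt0 pp; have mp0 : 0 < m * p by rewrite muln_gt0 m0.
apply: (irr_sorted_eq ltn_trans ltnn).
- apply: (sorted_filter ltn_trans); exact: sorted_divisors_ltn.
- exact: sorted_divisors_ltn.
move=> d; rewrite mem_filter -!dvdn_divisors //; apply/andP/idP.
- move=> [le_d /dvdnP [e mpE]].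
  have : p %| e * d by rewrite -mpE dvdn_mull.
  rewrite Euclid_dvdM // => /orP [/dvdnP [f eE]|pd].
    apply/dvdnP; exists f; apply/eqP; rewrite -(eqn_pmul2r p0) mpE eE.
    by rewrite mulnAC.
  have d0 : 0 < d by case: d mpE {le_d pd} => // /eqP; rewrite muln0 => /eqP mp0'; rewrite mp0' in mp0.
  have pd' : p <= d by apply: dvdn_leq.
  have : p * p <= m * p by rewrite (leq_trans _ le_d) // -mulnn leq_mul.
  by rewrite leq_pmul2r // leqNgt mp.
- move=> dm; split; last exact: dvdn_mulr.
  have ld : d <= m by apply: dvdn_leq.
  by rewrite -mulnn leq_mul // (leq_trans ld) // ltnW.
Qed.

(** * Word random access machine *)

(* Programs are structured (while) programs. They use registers, named in the
   program text, and an unbounded directly addressable memory. Each register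
   and each memory cell holds a word of w bits. *)

Inductive binop := Add | Sub | Mul | Div | Mod | Eq | Lt.

Inductive expr :=
  | Cst of nat
  | Reg of nat
  | Mem of expr
  | Op of binop & expr & expr.

(* [RunA] and [RunB] are the subroutine calls of Algorithms A and B: they
   execute the programs [algA] and [algB] below. *)
Inductive cmd :=
  | Skip
  | Assign of nat & expr
  | Store of expr & expr
  | Output of expr
  | Seq of cmd & cmd
  | If of expr & cmd & cmd
  | While of expr & cmd
  | RunA
  | RunB.

(* [log] is a ghost component: (k, v) is in [log] when some execution of
   Algorithm A or B for the integer k returned the value v. Programs cannot read
   it, and only [RunA] and [RunB] extend it. *)
Record state := State {
  reg : nat -> nat;
  ram : nat -> nat;
  out : seq nat;
  log : seq (nat * nat) }.

Definition upd (f : nat -> nat) (x v : nat) : nat -> nat :=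
  fun y => if y == x then v else f y.

Definition set_reg (s : state) (x v : nat) : state :=
  State (upd (reg s) x v) (ram s) (out s) (log s).
Definition set_mem (s : state) (x v : nat) : state :=
  State (reg s) (upd (ram s) x v) (out s) (log s).
Definition emit (s : state) (v : nat) : state :=
  State (reg s) (ram s) (rcons (out s) v) (log s).
Definition record_call (s : state) (k v : nat) : state :=
  State (reg s) (ram s) (out s) (rcons (log s) (k, v)).

Definition eval_op (o : binop) (a b : nat) : nat :=
  match o with
  | Add => a + b
  | Sub => a - b
  | Mul => a * b
  | Div => a %/ b
  | Mod => a %% b
  | Eq => a == b
  | Lt => a < b
  end.

Fixpoint eval (w : nat) (s : state) (e : expr) : nat :=
  match e with
  | Cst n => n %% 2 ^ w
  | Reg x => reg s x
  | Mem e => ram s (eval w s e)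
  | Op o e1 e2 => eval_op o (eval w s e1) (eval w s e2) %% 2 ^ w
  end.

Fixpoint cost (e : expr) : nat :=
  match e with
  | Cst _ | Reg _ => 1
  | Mem e => (cost e).+1
  | Op _ e1 e2 => (cost e1 + cost e2).+1
  end.

(** * Algorithms A and B *)

(* Calling conventions: [rLEN] is the length of the bit vector, [rA] its base
   address (one bit per memory cell), [rP] and [rQ] are the base addresses of
   divisor lists ([rP] holds the list of Algorithm A and the list D_p of
   Algorithm B), [rL] their common length, and [rW] receives the returned
   Hamming weight; Algorithm B moreover takes the initial weight in [rW]. *)
Definition rIN := 0.
Definition rLEN := 1.
Definition rA := 2.
Definition rP := 3.
Definition rQ := 4.
Definition rL := 5.
Definition rW := 6.
Definition rI := 7.
Definition rJ := 8.
Definition rK := 9.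

Definition incr (x : nat) : cmd := Assign x (Op Add (Reg x) (Cst 1)).

(* Base address [base] of a divisor list D, index [k]:
   D[k][0] is stored in cell base + 2k and D[k][1] in cell base + 2k + 1. *)
Definition div0 (base : nat) (k : expr) : expr :=
  Mem (Op Add (Reg base) (Op Mul (Cst 2) k)).
Definition div1 (base : nat) (k : expr) : expr :=
  Mem (Op Add (Reg base) (Op Add (Op Mul (Cst 2) k) (Cst 1))).

Definition cell (e : expr) : expr := Op Add (Reg rA) e.
Definition last_index : expr := Op Sub (Reg rL) (Cst 1).

Definition seqs (cs : seq cmd) : cmd := foldr Seq Skip cs.

Definition algA : cmd := seqs [::
  Assign rK (Cst 0);
  Assign rI (Cst 0);
  While (Op Lt (Reg rI) (Reg rLEN)) (seqs [::
    Store (cell (Reg rI)) (Cst 0);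
    incr rI]);
  Assign rI (Cst 1);
  While (Op Lt (Reg rI) (div0 rP last_index)) (seqs [::
    If (Op Eq (Reg rI) (div0 rP (Reg rK))) (incr rK) Skip;
    Assign rJ (Reg rI);
    While (Op Lt (Reg rJ) (div1 rP (Reg rK))) (seqs [::
      Store (cell (Op Mul (Reg rI) (Reg rJ))) (Cst 1);
      incr rJ]);
    incr rI]);
  Assign rW (Cst 0);
  Assign rI (Cst 0);
  While (Op Lt (Reg rI) (Reg rLEN)) (seqs [::
    Assign rW (Op Add (Reg rW) (Mem (cell (Reg rI))));
    incr rI])].

Definition algB : cmd := seqs [::
  Assign rK (Cst 0);
  Assign rI (Cst 1);
  While (Op Lt (Reg rI) (div0 rP last_index)) (seqs [::
    If (Op Eq (Reg rI) (div0 rP (Reg rK))) (incr rK) Skip;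
    Assign rJ (div1 rP (Reg rK));
    While (Op Lt (Reg rJ) (div1 rQ (Reg rK))) (seqs [::
      If (Op Eq (Mem (cell (Op Mul (Reg rI) (Reg rJ)))) (Cst 0))
        (seqs [::
          Store (cell (Op Mul (Reg rI) (Reg rJ))) (Cst 1);
          incr rW])
        Skip;
      incr rJ]);
    incr rI])].

Definition stores_list (s : state) (base : nat) (D : seq (nat * nat)) : Prop :=
  forall k, k < size D ->
    ram s (base + 2 * k) = (nth (0, 0) D k).1 /\
    ram s (base + 2 * k + 1) = (nth (0, 0) D k).2.

Definition disjoint_blocks (a la b lb : nat) : Prop :=
  a + la <= b \/ b + lb <= a.

(* Legitimate input of Algorithm A for the integer n. *)
Definition inputA (w : nat) (s : state) (n : nat) : Prop :=
  let D := divisor_list n in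
  [/\ 0 < n, reg s rLEN = n /\ reg s rL = size D, stores_list s (reg s rP) D,
      disjoint_blocks (reg s rP) (2 * size D) (reg s rA) n &
      reg s rP + 2 * size D < 2 ^ w /\ reg s rA + n < 2 ^ w].

(* Legitimate input of Algorithm B for m * q, given m * p: the two lists, and a
   bit vector of length m * q with its weight, which are those produced by
   Algorithm A for m * p, run from the state [sA] to the state [sA']. Instead of
   m < p it is only required that p and q do not divide m: the lists organised
   by the divisors of m then still have the same length, and Algorithm B still
   adds exactly the products missing for m * q. The bound needs this
   generality, since a positive proportion of the integers have no prime
   factor above their square root. *)
Definition inputB (w : nat) (s : state) (m p q : nat) : Prop :=
  [/\ [/\ 0 < m, prime p, prime q, p < q & ~~ (p %| m) && ~~ (q %| m)],
      reg s rL = size (divisors m),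
      stores_list s (reg s rP) (cofactor_list m p) /\
      stores_list s (reg s rQ) (cofactor_list m q),
      disjoint_blocks (reg s rP) (2 * size (divisors m)) (reg s rA) (m * q) /\
      disjoint_blocks (reg s rQ) (2 * size (divisors m)) (reg s rA) (m * q) &
      [/\ reg s rP + 2 * size (divisors m) < 2 ^ w,
          reg s rQ + 2 * size (divisors m) < 2 ^ w &
          reg s rA + m * q < 2 ^ w]].

Definition vectorB (s : state) (m p q : nat) (sA sA' : state) : Prop :=
  reg s rW = reg sA' rW /\
  forall t, t < m * q ->
    ram s (reg s rA + t) =
      if t < m * p then ram sA' (reg sA rA + t) else 0.

(** * Execution *)

(* [exec w c s s' t]: on words of w bits, the program c started in state s
   halts in state s' after t unit-time operations. The calls [RunA] and [RunB]
   have the effect and the running time of [algA] and [algB] (plus one), and are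
   stuck unless their inputs are legitimate. *)
Inductive exec (w : nat) : cmd -> state -> state -> nat -> Prop :=
  | ExecSkip s : exec w Skip s s 1
  | ExecAssign x e s :
      exec w (Assign x e) s (set_reg s x (eval w s e)) (cost e).+1
  | ExecStore e1 e2 s :
      exec w (Store e1 e2) s (set_mem s (eval w s e1) (eval w s e2))
        (cost e1 + cost e2).+1
  | ExecOutput e s : exec w (Output e) s (emit s (eval w s e)) (cost e).+1
  | ExecSeq c1 c2 s1 s2 s3 t1 t2 :
      exec w c1 s1 s2 t1 -> exec w c2 s2 s3 t2 ->
      exec w (Seq c1 c2) s1 s3 (t1 + t2)
  | ExecIfTrue e c1 c2 s s' t :
      eval w s e != 0 -> exec w c1 s s' t ->
      exec w (If e c1 c2) s s' (cost e + t).+1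
  | ExecIfFalse e c1 c2 s s' t :
      eval w s e = 0 -> exec w c2 s s' t ->
      exec w (If e c1 c2) s s' (cost e + t).+1
  | ExecWhileTrue e c s1 s2 s3 t1 t2 :
      eval w s1 e != 0 -> exec w c s1 s2 t1 -> exec w (While e c) s2 s3 t2 ->
      exec w (While e c) s1 s3 (cost e + t1 + t2).+1
  | ExecWhileFalse e c s :
      eval w s e = 0 -> exec w (While e c) s s (cost e).+1
  | ExecRunA n s s' t :
      inputA w s n -> exec w algA s s' t ->
      exec w RunA s (record_call s' n (reg s' rW)) t.+1
  | ExecRunB m p q sA sA' tA s s' t :
      inputA w sA (m * p) -> exec w algA sA sA' tA ->
      inputB w s m p q -> vectorB s m p q sA sA' ->
      exec w algB s s' t ->
      exec w RunB s (record_call s' (m * q) (reg s' rW)) t.+1.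

Definition init (n : nat) : state :=
  State (upd (fun=> 0) rIN n) (fun=> 0) [::] [::].

(* The binary length of n >= 1 is (trunc_log 2 n).+1. *)
Definition word_size (c n : nat) : nat := c * (trunc_log 2 n).+1.

(* On input n the program P outputs M(1), ..., M(n), in this order, in time t,
   and for every k <= n it computes delta(k) by a call of Algorithm A or B. *)
Definition tabulates (c : nat) (P : cmd) (n t : nat) : Prop :=
  exists s : state,
    [/\ exec (word_size c n) P (init n) s t,
        out s = [seq M k | k <- iota 1 n] &
        forall k, 1 <= k <= n -> (k, delta k) \in log s].

Local Open Scope ring_scope.

Definition L (R : realType) (n : nat) : R :=
  expR (Num.sqrt (ln n%:R * ln (ln n%:R))).

(* Main.v *)
From HB Require Import structures.
From mathcomp Require Import all_boot all_order all_algebra.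
From mathcomp Require Import all_classical all_reals all_analysis.
From mathcomp Require Import zify ring lra.
Require Import Defs.
Set Implicit Arguments.
Unset Strict Implicit.
Unset Printing Implicit Defensive.

(** Writing k = m q with q the largest prime factor of k, group the integers k up
    to n by the cofactor m.  For a fixed m, the k with q > P(m), the largest prime
    factor of m, form a chain: one call of Algorithm A for the smallest prime, then
    calls of Algorithm B from each prime p to the next one q.  Such a call costs
    O((q - p) m log n), so the chain telescopes to O(n log n).  The k with q = P(m)
    are given to Algorithm A, again once per m and at the cost O(n log n).  A value
    m matters only if m P(m) <= n, so that the whole program runs in time
    O(n log n) times the number of these m ([tabulates_tabulate]).  No smoothness
    threshold is computed by the program; one enters only in the analysis.

    Correctness rests on the description of the marked cells.  If t k = a b with
    a, b < k, dividing out gcd(a, k) shows that t = i j with i < d and j < k / d for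
    a divisor d of k ([delta_bitP]).  For fixed i the best d is the least divisor
    above i, which is what the counter of the algorithms tracks
    ([delta_bit_rowsA], [delta_bit_rowsB]).

    For the count, let y = L^(1 / sqrt 2).  If m P(m) <= n then m <= n / y or m is
    y-smooth.  Rankin's inequality bounds the number of y-smooth m <= n by n^s times
    the exponential of 4 times the sum of p^(-s) over the primes p <= y ([rankin]).
    With y^(1 - s) = sqrt (ln n) / ln (ln n), and with Chebyshev's bound giving that
    the sum of 1 / p over p <= n is O(ln (ln n)) ([prime_sum_le]), the exponential
    is only exp(O(sqrt (ln n))), whereas n^(s - 1) is y^(-1) up to the same kind of
    factor.  Since exp(sqrt (ln n)) is L^(1 / sqrt (ln (ln n))), the total is
    n^2 / L^(1 / sqrt 2 - 40 / sqrt (ln (ln n))) up to a constant. *)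

(** * The products counted by delta *)

Lemma mem_mult_tableP n x :
  reflect (exists a b, [/\ 0 < a <= n, 0 < b <= n & x = a * b])
          (x \in mult_table n).
Proof.
rewrite mem_undup; apply: (iffP allpairsP).
  case=> -[a b] /= [ha hb ->]; exists a, b; move: ha hb.
  by rewrite !mem_iota !add1n !ltnS => -> ->.
case=> a [b [ha hb ->]]; exists (a, b).
by rewrite /= !mem_iota !add1n !ltnS ha hb.
Qed.

(** The bit vector of Algorithm A for [k], as a function of the cell: [delta k] is
    its weight. *)
Definition delta_bit (k t : nat) : bool := (0 < t) && (t * k \in mult_table k.-1).

(** From [t * k = a * b] with [a, b < k], take [d = k / gcd(a, k)]: it is coprime
    to [a / gcd(a, k)], hence divides [b], and [t = (a / gcd(a, k)) * (b / d)]. *)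
Lemma delta_bitP k t : 0 < k ->
  reflect (exists d i j, [/\ d %| k, 0 < i < d, 0 < j < k %/ d & t = i * j])
          (delta_bit k t).
Proof.
move=> k0; apply: (iffP andP).
  case=> t0 /mem_mult_tableP [a [b [/andP [a0 ak] /andP [b0 bk] tk]]].
  set g := gcdn a k; have g0 : 0 < g by rewrite gcdn_gt0 a0.
  have gk : g %| k := dvdn_gcdr a k; have ga : g %| a := dvdn_gcdl a k.
  set d := k %/ g; set i := a %/ g.
  have kE : k = d * g by rewrite divnK.
  have aE : a = i * g by rewrite divnK.
  have d0 : 0 < d by case: d kE => // kE; rewrite kE in k0.
  have i0 : 0 < i by case: i aE => // aE; rewrite aE in a0.
  have cid : coprime d i.
    rewrite coprime_sym /coprime -(eqn_pmul2r g0) mul1n muln_gcdl -aE -kE.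
    by apply/eqP; rewrite /g.
  have tdib : t * d = i * b.
    apply/eqP; rewrite -(eqn_pmul2r g0) -mulnA -kE tk aE; apply/eqP; lia.
  have : d %| b by rewrite -(Gauss_dvdr b cid) -tdib dvdn_mull.
  case/dvdnP => j bE.
  exists d, i, j; split.
  - by rewrite kE dvdn_mulr.
  - rewrite i0 -(ltn_pmul2r g0) -aE -kE; lia.
  - rewrite {1}kE mulKn //; have : j * d < g * d by rewrite -bE [g * d]mulnC -kE; lia.
    by rewrite ltn_pmul2r // => ->; rewrite andbT; case: j bE => // bE; rewrite bE in b0.
  - by apply/eqP; rewrite -(eqn_pmul2r d0) tdib bE; apply/eqP; lia.
case=> d [i [j [dk /andP [i0 id] /andP [j0 jd] ->]]]; split; first by rewrite muln_gt0 i0.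
have kE : k = (k %/ d) * d by rewrite divnK.
apply/mem_mult_tableP; exists (i * (k %/ d)), (j * d); split.
- rewrite muln_gt0 i0 /=; have := ltn_mul2r (k %/ d) i d; nia.
- rewrite muln_gt0 j0 /=; have := ltn_mul2r d j (k %/ d); nia.
- by rewrite {1}kE; lia.
Qed.

Lemma delta_bit_lt k t : 0 < k -> delta_bit k t -> t < k.
Proof.
move=> k0 /(delta_bitP _ k0) [d [i [j [dk /andP [i0 id] /andP [j0 jd] ->]]]].
have kE : k = (k %/ d) * d by rewrite divnK.
rewrite kE [_ * d]mulnC; apply: ltn_mul => //; lia.
Qed.

Lemma delta_sum k : 0 < k -> delta k = \sum_(t < k) delta_bit k t.
Proof.
move=> k0; rewrite /delta -sum1_count big_mkcond /=.
have -> : \sum_(t < k) delta_bit k t = \sum_(0 <= t < k.+1) delta_bit k t.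
  rewrite big_nat_recr //= big_mkord.
  by case: (boolP (delta_bit k k)) => [/(delta_bit_lt k0)|]; rewrite ?ltnn ?addn0.
rewrite big_nat_recl //= /delta_bit add0n.
rewrite -[in LHS](addn0 1) iotaDl big_map /index_iota subn0.
by apply: eq_bigr => i _; rewrite add1n /=; case: ifP.
Qed.

(** A product that is not in the smaller table has [k] as a factor, so the new
    entries are multiples [t * k] with [t <= k]. *)
Lemma M_rec k : 0 < k -> M k = M k.-1 + (k - delta k).
Proof.
move=> k0; rewrite /M.
set B := [seq t * k | t <- iota 1 k & t * k \notin mult_table k.-1].
have -> : k - delta k = size B.
  rewrite size_map size_filter /delta.
  have := count_predC (fun m => m * k \in mult_table k.-1) (iota 1 k).
  by rewrite size_iota => {1}<-; rewrite addKn.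
rewrite -size_cat; apply: perm_size; apply: uniq_perm.
- exact: undup_uniq.
- rewrite cat_uniq undup_uniq /=; apply/andP; split.
    by apply/hasPn => x /mapP [t]; rewrite mem_filter => /andP [ht _] ->.
  rewrite map_inj_uniq ?filter_uniq ?iota_uniq // => x y /eqP.
  by rewrite eqn_pmul2r // => /eqP.
move=> x; rewrite mem_cat; apply/idP/idP.
  case/mem_mult_tableP => a [b [/andP [a0 ak] /andP [b0 bk] xE]].
  case: (boolP (x \in mult_table k.-1)) => //= xn.
  have [t tk xt] : exists2 t, 0 < t <= k & x = t * k.
    case: (ltnP a k) => hak; last first.
      by exists b; rewrite ?b0 // xE (_ : a = k) 1?mulnC //; lia.
    case: (ltnP b k) => hbk; last first.
      by exists a; rewrite ?a0 // xE (_ : b = k) //; lia.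
    case/negP: xn; apply/mem_mult_tableP; exists a, b; split => //; lia.
  apply/mapP; exists t => //; rewrite mem_filter -xt xn mem_iota; lia.
case/orP => [/mem_mult_tableP [a [b [ha hb ->]]]|/mapP [t]].
  by apply/mem_mult_tableP; exists a, b; split => //; lia.
rewrite mem_filter mem_iota => /andP [_ ht] ->.
by apply/mem_mult_tableP; exists t, k; split; lia.
Qed.

(** * Divisor lists and rows of marked cells *)

(** The index is the value of the counter [rK] at row [i]; when no entry is
    [>= i] the default 0 is returned. *)
Definition least_ge (ds : seq nat) (i : nat) : nat :=
  nth 0 ds (count (fun d => d < i) ds).

Lemma least_geP ds i : sorted ltn ds -> has (fun d => i <= d) ds ->
  [/\ count (fun d => d < i) ds < size ds, least_ge ds i \in ds, i <= least_ge ds i &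
      forall d, d \in ds -> i <= d -> least_ge ds i <= d].
Proof.
rewrite /least_ge; elim: ds => //= x s IH xs /=.
have ss := path_sorted xs; have xall := order_path_min ltn_trans xs.
case: (ltnP x i) => /= xi.
  move=> H; have [h1 h2 h3 h4] := IH ss H; rewrite add1n; split=> //.
  - by rewrite in_cons h2 orbT.
  - move=> d; rewrite in_cons => /orP [/eqP ->|]; [lia | exact: h4].
move=> _; have -> : count (fun d => d < i) s = 0.
  apply/eqP; rewrite -leqn0 leqNgt -has_count; apply/hasPn => d /(allP xall); lia.
rewrite mem_head; split=> // d; rewrite in_cons => /orP [/eqP ->//|/(allP xall)] /=; lia.
Qed.

(** One comparison per row keeps the counter equal to the number of divisors
    passed so far, because the list is strictly increasing. *)
Lemma count_ltS ds i : sorted ltn ds -> has (fun d => i <= d) ds ->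
  count (fun d => d < i.+1) ds = count (fun d => d < i) ds + (i == least_ge ds i).
Proof.
move=> sd hd; have [_ h2 h3 h4] := least_geP sd hd.
have ud : uniq ds by apply: sorted_uniq sd; [exact: ltn_trans | exact: ltnn].
have -> : (i == least_ge ds i) = (i \in ds) :> bool.
  apply/eqP/idP => [-> //|ids]; apply/eqP; rewrite eqn_leq h3 /=; exact: h4.
rewrite -(count_uniq_mem i ud) -count_predUI addnC.
rewrite (_ : count (predI _ _) ds = 0) ?add0n; last first.
  by apply/eqP; rewrite -leqn0 leqNgt -has_count; apply/hasPn => d _ /=; lia.
by apply: eq_count => d /=; rewrite ltnS leq_eqVlt orbC.
Qed.

Lemma le_last_sorted ds d : sorted ltn ds -> d \in ds -> d <= last 0 ds.
Proof.
case: ds => //= x s xs; elim: s x xs d => [|y s IH] x /=.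
  by move=> _ d; rewrite inE => /eqP ->.
move=> /andP [xy ys] d; rewrite in_cons => /orP [/eqP ->|]; last exact: IH.
have := IH y ys y (mem_head _ _); lia.
Qed.

Definition small_divisors (k : nat) : seq nat := [seq d <- divisors k | d ^ 2 <= k].

Lemma divisor_listE k : divisor_list k = [seq (d, k %/ d) | d <- small_divisors k].
Proof. by []. Qed.

Lemma sorted_small_divisors k : sorted ltn (small_divisors k).
Proof. by apply: (sorted_filter ltn_trans); exact: sorted_divisors_ltn. Qed.

Lemma mem_small_divisors k d : 0 < k -> d \in small_divisors k = (d ^ 2 <= k) && (d %| k).
Proof. by move=> k0; rewrite mem_filter -dvdn_divisors. Qed.

(** By symmetry the smaller of [d], [k / d] bounds the smaller of the two factors,
    which becomes the row index [i]; replacing [d] by the least divisor above [i]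
    only enlarges the range of [j]. *)
Lemma delta_bit_rowsA k t : 0 < k -> let ds := small_divisors k in
  reflect (exists i j, [/\ 0 < i < last 0 ds, i <= j < k %/ least_ge ds i.+1 & t = i * j])
          (delta_bit k t).
Proof.
move=> k0 ds; have sd := sorted_small_divisors k.
apply: (iffP (delta_bitP _ k0)); last first.
  case=> i [j [/andP [i0 il] /andP [ij jx] ->]].
  have hi : has (fun d => i.+1 <= d) ds.
    apply/hasP; exists (last 0 ds) => //.
    by case: (ds) il => //= x s _; rewrite mem_last.
  have [_ h2 h3 h4] := least_geP sd hi.
  exists (least_ge ds i.+1), i, j; split=> //; last by rewrite jx (leq_trans i0 ij).
    by move: h2; rewrite mem_small_divisors // => /andP [].
  by rewrite i0 h3.
suff wl : forall d i j, d * d <= k -> d %| k -> 0 < i < d -> 0 < j < k %/ d ->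
    exists i' j', [/\ 0 < i' < last 0 ds, i' <= j' < k %/ least_ge ds i'.+1
                   & i * j = i' * j'].
  case=> d [i [j [dk hi hj ->]]].
  case: (leqP (d * d) k) => ddk; first exact: (wl d).
  have kE : k = (k %/ d) * d by rewrite divnK.
  have d0 : 0 < d by lia.
  have e0 : 0 < k %/ d by lia.
  have ee : k %/ (k %/ d) = d by rewrite {1}kE mulKn.
  case: (wl (k %/ d) j i) => //.
  - have : k %/ d < d by rewrite ltn_divLR.
    nia.
  - by rewrite {2}kE dvdn_mulr.
  - by rewrite ee.
  - by move=> i' [j' [h1 h2 h3]]; exists i', j'; rewrite [i * j]mulnC.
move=> d i j ddk dk /andP [i0 id] /andP [j0 jd].
have dds : d \in ds by rewrite mem_small_divisors // -mulnn ddk.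
have dl : d <= last 0 ds := le_last_sorted sd dds.
have dle : d <= k %/ d by rewrite leq_divRL //; lia.
have key a : a < d -> k %/ d <= k %/ least_ge ds a.+1.
  move=> ad; have hi : has (fun d => a.+1 <= d) ds by apply/hasP; exists d.
  have [_ h2 h3 h4] := least_geP sd hi.
  by apply: leq_div2l; [exact: leq_trans h3 | exact: h4].
case: (leqP i j) => ij.
  exists i, j; split=> //; first by rewrite i0 (leq_trans id).
  by rewrite ij (leq_trans jd) // key.
have jd' := ltn_trans ij id.
exists j, i; split; [by rewrite j0 (leq_trans jd') | | exact: mulnC].
by rewrite (ltnW ij) (leq_trans id) // (leq_trans dle) // key.
Qed.

Lemma last_divisors m : 0 < m -> last 0 (divisors m) = m.
Proof.
move=> m0; apply/eqP; rewrite eqn_leq; apply/andP; split.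
  have : last 0 (divisors m) \in divisors m.
    have := divisors_id m0; case: (divisors m) => //= x s _; exact: mem_last.
  by rewrite -dvdn_divisors //; apply: dvdn_leq.
by apply: le_last_sorted; [exact: sorted_divisors_ltn | exact: divisors_id].
Qed.

(** Of two complementary divisors of [m * q] exactly one divides [m], as [q] does
    not.  This one can always be taken as the bound of the row index, at the price
    of giving up [i <= j]. *)
Lemma delta_bit_rowsB m q t : 0 < m -> prime q -> ~~ (q %| m) -> let ds := divisors m in
  reflect (exists i j, [/\ 0 < i < m, 0 < j < (m * q) %/ least_ge ds i.+1 & t = i * j])
          (delta_bit (m * q) t).
Proof.
move=> m0 pq qm ds; have sd : sorted ltn ds := sorted_divisors_ltn m.
have q0 := prime_gt0 pq; have mq0 : 0 < m * q by rewrite muln_gt0 m0.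
apply: (iffP (delta_bitP _ mq0)); last first.
  case=> i [j [/andP [i0 il] /andP [j0 jx] ->]].
  have hi : has (fun d => i.+1 <= d) ds by apply/hasP; exists m => //; exact: divisors_id.
  have [_ h2 h3 h4] := least_geP sd hi.
  exists (least_ge ds i.+1), i, j; split=> //; [|by rewrite i0 h3|by rewrite j0 jx].
  by move: h2; rewrite -dvdn_divisors // => h; apply: dvdn_mulr.
suff wl : forall d i j, d %| m -> 0 < i < d -> 0 < j < (m * q) %/ d ->
    exists i' j', [/\ 0 < i' < m, 0 < j' < (m * q) %/ least_ge ds i'.+1
                   & i * j = i' * j'].
  case=> d [i [j [dk hi hj ->]]].
  have kE : m * q = ((m * q) %/ d) * d by rewrite divnK.
  have d0 : 0 < d by lia.
  have e0 : 0 < (m * q) %/ d by lia.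
  have ee : (m * q) %/ ((m * q) %/ d) = d by rewrite {1}kE mulKn.
  have : q %| ((m * q) %/ d) * d by rewrite -kE dvdn_mull.
  rewrite Euclid_dvdM // orbC => /orP [] /dvdnP [e eE].
    case: (wl ((m * q) %/ d) j i) => //; last 2 first.
    - by rewrite ee.
    - by move=> i' [j' [h1 h2 h3]]; exists i', j'; rewrite [i * j]mulnC.
    apply/dvdnP; exists e; apply/eqP; rewrite -(eqn_pmul2r q0) {1}kE {2}eE.
    by rewrite mulnA [e * _]mulnC.
  apply: (wl d) => //.
  apply/dvdnP; exists e; apply/eqP; rewrite -(eqn_pmul2r q0) {1}kE eE.
  by rewrite mulnAC.
move=> d i j dk /andP [i0 id] /andP [j0 jd].
have dm : d <= m by apply: dvdn_leq.
exists i, j; split=> //; first lia.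
have dds : d \in ds by rewrite -dvdn_divisors.
have hi : has (fun d => i.+1 <= d) ds by apply/hasP; exists d.
have [_ h2 h3 h4] := least_geP sd hi.
rewrite j0 (leq_trans jd) //; apply: leq_div2l; [exact: leq_trans h3 | exact: h4].
Qed.

(** * Reasoning about programs and their running time *)

(** [value] is [eval] without the reduction modulo [2 ^ w]; [fits] gathers the
    bounds under which both agree. *)
Fixpoint value (s : state) (e : expr) : nat :=
  match e with
  | Cst n => n
  | Reg x => reg s x
  | Mem e => ram s (value s e)
  | Op o e1 e2 => eval_op o (value s e1) (value s e2)
  end.

Fixpoint fits (W : nat) (s : state) (e : expr) : Prop :=
  match e with
  | Cst n => n < W
  | Reg _ => True
  | Mem e => fits W s e
  | Op o e1 e2 =>
    [/\ fits W s e1, fits W s e2 &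
        match o with
        | Add | Mul => eval_op o (value s e1) (value s e2) < W
        | Sub | Div | Mod => value s e1 < W
        | Eq | Lt => 1 < W
        end]
  end.

Lemma eval_value w s e : fits (2 ^ w) s e -> eval w s e = value s e.
Proof.
elim: e => [n|x|e IH|o e1 IH1 e2 IH2] //=.
- by move=> h; rewrite modn_small.
- by move=> /IH ->.
case=> /IH1 -> /IH2 -> h; rewrite modn_small //; case: o h => //= h.
- exact: leq_ltn_trans (leq_subr _ _) h.
- exact: leq_ltn_trans (leq_div _ _) h.
- exact: leq_ltn_trans (leq_mod _ _) h.
- exact: leq_ltn_trans (leq_b1 _) h.
- exact: leq_ltn_trans (leq_b1 _) h.
Qed.

Fixpoint wregs (c : cmd) : seq nat :=
  match c with
  | Assign x _ => [:: x]
  | Seq c1 c2 | If _ c1 c2 => wregs c1 ++ wregs c2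
  | While _ c => wregs c
  | RunA | RunB => [:: rW; rI; rJ; rK]
  | _ => [::]
  end.

Fixpoint silent (c : cmd) : bool :=
  match c with
  | Output _ => false
  | Seq c1 c2 | If _ c1 c2 => silent c1 && silent c2
  | While _ c => silent c
  | _ => true
  end.

Fixpoint callfree (c : cmd) : bool :=
  match c with
  | RunA | RunB => false
  | Seq c1 c2 | If _ c1 c2 => callfree c1 && callfree c2
  | While _ c => callfree c
  | _ => true
  end.

(** What the text of a command shows that it cannot change.  Loops then need no
    invariants for the registers that their bodies do not mention. *)
Definition frame (c : cmd) (s s' : state) : Prop :=
  [/\ forall x, x \notin wregs c -> reg s' x = reg s x,
      silent c -> out s' = out s & callfree c -> log s' = log s].

Lemma frame_refl c s : frame c s s. Proof. by []. Qed.

Lemma frame_trans c s1 s2 s3 : frame c s1 s2 -> frame c s2 s3 -> frame c s1 s3.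
Proof.
case=> a1 b1 c1 [a2 b2 c2]; split=> [x hx|h|h].
- by rewrite a2 ?a1.
- by rewrite b2 ?b1.
- by rewrite c2 ?c1.
Qed.

Lemma exec_frame w c s s' t : exec w c s s' t -> frame c s s'.
Proof.
elim=> {c s s' t} //.
- by move=> x e s; split=> [/= y|/= h|/= h] //; rewrite inE /upd => /negbTE ->.
- move=> c1 c2 s1 s2 s3 t1 t2 _ [a1 b1 d1] _ [a2 b2 d2]; split=> [/= x|/= /andP[]|/= /andP[]].
  + by rewrite mem_cat negb_or => /andP [h1 h2]; rewrite a2 ?a1.
  + by move=> /b1 <- /b2 <-.
  + by move=> /d1 <- /d2 <-.
- move=> e c1 c2 s s' t _ _ [a1 b1 d1]; split=> [/= x|/= /andP[]|/= /andP[]]; auto.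
  by rewrite mem_cat negb_or => /andP [h1 h2]; rewrite a1.
- move=> e c1 c2 s s' t _ _ [a1 b1 d1]; split=> [/= x|/= /andP[]|/= /andP[]]; auto.
  by rewrite mem_cat negb_or => /andP [h1 h2]; rewrite a1.
- by move=> e c s1 s2 s3 t1 t2 _ _ h1 _ h2; exact: frame_trans h1 h2.
- move=> n s s' t _ _ [a1 b1 d1]; split=> [/= x hx|/= h|/= h] //; last by rewrite b1.
  by rewrite a1 //; move: hx; rewrite !inE /=; lia.
- move=> m p q sA sA' tA s s' t _ _ _ _ _ _ [a1 b1 d1]; split=> [/= x hx|/= h|/= h] //; last by rewrite b1.
  by rewrite a1 //; move: hx; rewrite !inE /=; lia.
Qed.

(** A name for this equation, so that the arithmetic decision procedures do not
    unfold the power in every goal. *)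
Definition word_bound (w W : nat) : Prop := W = 2 ^ w.

Section Rules.
Variables (w W : nat).
Hypothesis EW : word_bound w W.

(** Total correctness with time: the postcondition receives the final state and the
    number of operations performed. *)
Definition wp (c : cmd) (s : state) (Q : state -> nat -> Prop) : Prop :=
  exists s' t, exec w c s s' t /\ Q s' t.

Lemma wp_mono c s (Q Q' : state -> nat -> Prop) :
  (forall s' t, frame c s s' -> Q s' t -> Q' s' t) -> wp c s Q -> wp c s Q'.
Proof. by move=> h [s' [t [ex q]]]; exists s', t; split=> //; apply: h q; apply: exec_frame ex. Qed.

Lemma wp_skip s (Q : state -> nat -> Prop) : Q s 1 -> wp Skip s Q.
Proof. by move=> h; exists s, 1; split=> //; constructor. Qed.

Lemma wp_assign x e s (Q : state -> nat -> Prop) :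
  fits W s e -> Q (set_reg s x (value s e)) (cost e).+1 -> wp (Assign x e) s Q.
Proof.
rewrite EW => h q; exists (set_reg s x (value s e)), (cost e).+1; split=> //.
by rewrite -(eval_value h); constructor.
Qed.

Lemma wp_store e1 e2 s (Q : state -> nat -> Prop) :
  fits W s e1 -> fits W s e2 ->
  Q (set_mem s (value s e1) (value s e2)) (cost e1 + cost e2).+1 -> wp (Store e1 e2) s Q.
Proof.
rewrite EW => h1 h2 q; exists (set_mem s (value s e1) (value s e2)), (cost e1 + cost e2).+1.
by split=> //; rewrite -(eval_value h1) -(eval_value h2); constructor.
Qed.

Lemma wp_output e s (Q : state -> nat -> Prop) :
  fits W s e -> Q (emit s (value s e)) (cost e).+1 -> wp (Output e) s Q.
Proof.
rewrite EW => h q; exists (emit s (value s e)), (cost e).+1; split=> //.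
by rewrite -(eval_value h); constructor.
Qed.

Lemma wp_seq c1 c2 s (Q : state -> nat -> Prop) :
  wp c1 s (fun s1 t1 => wp c2 s1 (fun s2 t2 => Q s2 (t1 + t2))) -> wp (Seq c1 c2) s Q.
Proof.
move=> [s1 [t1 [ex1 [s2 [t2 [ex2 q]]]]]]; exists s2, (t1 + t2); split=> //.
exact: ExecSeq ex1 ex2.
Qed.

Lemma wp_if e c1 c2 s (Q : state -> nat -> Prop) :
  fits W s e ->
  (value s e != 0 -> wp c1 s (fun s' t => Q s' (cost e + t).+1)) ->
  (value s e = 0 -> wp c2 s (fun s' t => Q s' (cost e + t).+1)) ->
  wp (If e c1 c2) s Q.
Proof.
rewrite EW => h; rewrite -(eval_value h) => h1 h2; case: (eqVneq (eval w s e) 0) => he.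
  have [s' [t [ex q]]] := h2 he; exists s', (cost e + t).+1; split=> //.
  exact: ExecIfFalse.
have [s' [t [ex q]]] := h1 he; exists s', (cost e + t).+1; split=> //.
exact: ExecIfTrue.
Qed.

(** The invariant also speaks of the time spent since the start of the loop, so
    that amortised bounds are ordinary invariants. *)
Lemma wp_for e c s0 (I : nat -> state -> nat -> Prop) (Q : state -> nat -> Prop) a b :
  a <= b -> I a s0 0 ->
  (forall i s t, a <= i < b -> frame c s0 s -> I i s t ->
     [/\ fits W s e, value s e != 0 &
        wp c s (fun s' t' => I i.+1 s' ((cost e + t').+1 + t))]) ->
  (forall s t, frame c s0 s -> I b s t ->
     [/\ fits W s e, value s e = 0 & Q s ((cost e).+1 + t)]) ->
  wp (While e c) s0 Q.
Proof.
rewrite EW => ab I0 step fin.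
suff H n : forall i s t, b - i = n -> a <= i <= b -> frame c s0 s -> I i s t ->
    wp (While e c) s (fun s' t' => Q s' (t + t')).
  have [|s' [t [ex q]]] := H _ a s0 0 erefl _ (frame_refl c s0) I0; first by rewrite leqnn.
  by exists s', t.
elim: n => [|n IH] i s t bi aib fr Ii.
  have ib : i = b by lia.
  rewrite ib in Ii; have [h1 h2 q] := fin s t fr Ii.
  exists s, (cost e).+1; split; last by rewrite addnC.
  by apply: ExecWhileFalse; rewrite (eval_value h1).
have [|h1 h2 [s1 [t1 [ex1 I1]]]] := step i s t _ fr Ii; first lia.
have [||s2 [t2 [ex2 q2]]] := IH i.+1 s1 _ _ _ (frame_trans fr (exec_frame ex1)) I1; try lia.
exists s2, (cost e + t1 + t2).+1; split.
  by apply: ExecWhileTrue ex1 ex2; rewrite (eval_value h1).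
by move: q2; congr Q; lia.
Qed.

End Rules.

Definition put (base : nat) (e1 e2 : expr) : cmd := seqs [::
  Store (Op Add (Reg base) (Op Mul (Cst 2) (Reg rL))) e1;
  Store (Op Add (Reg base) (Op Add (Op Mul (Cst 2) (Reg rL)) (Cst 1))) e2].

(** Register names are constants, whose equality is decided here by computation;
    writes to symbolic addresses are left alone. *)
Ltac usimp := rewrite /=; repeat match goal with
  | |- context [upd ?f ?x ?v ?y] => is_const x; is_const y;
      let b := eval cbv in (y == x) in
      match b with
      | true => change (upd f x v y) with v
      | false => change (upd f x v y) with (f y)
      end
  end; rewrite /=.

Ltac side := usimp; repeat (match goal with |- and3 _ _ _ => split end);
  try (first [done | assumption | lia]).

Ltac wstep :=
  match goal with EW : word_bound _ _ |- _ =>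
    match goal with
    | |- wp _ (seqs _) _ _ => rewrite /seqs /foldr
    | |- wp _ (Seq _ _) _ _ => apply: wp_seq
    | |- wp _ Skip _ _ => apply: wp_skip
    | |- wp _ (put _ _ _) _ _ => rewrite /put
    | |- wp _ (incr _) _ _ => rewrite /incr
    | |- wp _ (Assign _ _) _ _ => apply: (wp_assign EW); [side|]
    | |- wp _ (Store _ _) _ _ => apply: (wp_store EW); [side|side|]
    | |- wp _ (Output _) _ _ => apply: (wp_output EW); [side|]
    end
  end; usimp.

Ltac wsteps := repeat wstep.

(** The value of register [x] before a command that does not write it, from the
    frame [fr] of this command. *)
Ltac wreg fr x :=
  let H := fresh "e" x in
  (have H := (let: And3 f _ _ := fr in f) x isT); cbn in H.

(** * Cells marked row by row *)

(** The cells set when the scan has reached column [j] of row [i], those of [base]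
    being set at the start. *)
Definition marked (base : pred nat) (row : nat -> nat -> bool) (i j t : nat) : bool :=
  base t || `[< exists i' j', [/\ 0 < i', (i' < i) || ((i' == i) && (j' < j)),
                                   row i' j' & t = i' * j'] >].

Lemma marked_cell base (row : nat -> nat -> bool) i j t : 0 < i -> row i j ->
  marked base row i j.+1 t = (t == i * j) || marked base row i j t.
Proof.
move=> i0 rij; rewrite /marked orbCA; congr (_ || _).
apply/asboolP/orP.
  case=> i' [j' [h1 h2 h3 ->]]; case: (eqVneq (i' * j') (i * j)) => [|ne]; first by left.
  right; apply/asboolP; exists i', j'; split=> //.
  case/orP: h2 => [->//|/andP [/eqP ei hj]]; rewrite ei eqxx /=.
  by case: (eqVneq j' j) => [ej|]; [rewrite ei ej eqxx in ne | lia].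
case=> [/eqP ->|/asboolP [i' [j' [h1 h2 h3 ->]]]].
  by exists i, j; split=> //; rewrite eqxx ltnSn orbT.
exists i', j'; split=> //; move: h2; clear; lia.
Qed.

Lemma marked_row_start base (row : nat -> nat -> bool) i j t : (forall j', row i j' -> j <= j') ->
  marked base row i j t = marked base row i 0 t.
Proof.
move=> hj; rewrite /marked; congr (_ || _); apply/asboolP/asboolP.
  case=> i' [j' [h1 h2 h3 ->]]; exists i', j'; split=> //.
  case/orP: h2 => [->//|/andP [/eqP ei hj']]; move: h3; rewrite ei => /hj; lia.
by move=> [i' [j' [h1 h2 h3 ->]]]; exists i', j'; split=> //; lia.
Qed.

Lemma marked_row_end base (row : nat -> nat -> bool) i j t : (forall j', row i j' -> j' < j) ->
  marked base row i j t = marked base row i.+1 0 t.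
Proof.
move=> hj; rewrite /marked; congr (_ || _); apply/asboolP/asboolP.
  by move=> [i' [j' [h1 h2 h3 ->]]]; exists i', j'; split=> //; lia.
case=> i' [j' [h1 h2 h3 ->]]; exists i', j'; split=> //.
case: (eqVneq i' i) => ei /=; last lia.
by rewrite ei in h3; rewrite hj // orbT.
Qed.

Lemma disjoint_list_cell P l a N j : disjoint_blocks P (2 * l) a N -> j < l ->
  (P + 2 * j < a) || (a + N <= P + 2 * j) /\
  (P + (2 * j + 1) < a) || (a + N <= P + (2 * j + 1)).
Proof. by rewrite /disjoint_blocks => -[] h jl; split; lia. Qed.

Lemma least_ge_last ds i : sorted ltn ds -> i < last 0 ds -> has (fun d => i.+1 <= d) ds.
Proof.
move=> sd il; apply/hasP; exists (last 0 ds) => //.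
by case: ds sd il => // x s _ _; exact: mem_last.
Qed.

(** * Algorithm A *)

(** A bound for the number of inner steps of Algorithm A: the columns of row [i]
    stop at [k / d] for some [d > i]. *)
Definition quot_sum (k : nat) : nat := \sum_(1 <= i < k.+1) k %/ i.

Lemma quot_sum_ge k : 0 < k -> k <= quot_sum k.
Proof. by move=> k0; rewrite /quot_sum big_ltn // divn1 leq_addr. Qed.

Section Algs.
Variables (w W : nat).
Hypothesis EW : word_bound w W.

Definition rowA (k i j : nat) : bool := i <= j < k %/ least_ge (small_divisors k) i.+1.

(** The list tells the least divisor above each row index, so the scan marks the
    cells of [delta_bit_rowsA]; the last loop computes their number.  The time is
    dominated by the rows, at most [k / i] steps for row [i]. *)
Lemma algA_wp s k : inputA w s k ->
  wp w algA s (fun s' t =>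
    [/\ reg s' rW = delta k,
        forall t, t < k -> ram s' (reg s rA + t) = delta_bit k t,
        forall x, (x < reg s rA) || (reg s rA + k <= x) -> ram s' x = ram s x &
        t <= 500 * quot_sum k]).
Proof.
case=> [k0 [hLEN hL] hst hdis [hb1 hb2]].
rewrite -?EW in hb1 hb2; move: hL hst hdis hb1; rewrite divisor_listE size_map.
have sd := sorted_small_divisors k.
move: (sd); set ds := small_divisors k => _.
set l := size ds => hL hst hdis hb1.
set a0 := reg s rA; set P := reg s rP.
rewrite -/a0 -/P in hdis hb1 hb2 hst.
have ds1 : 1 \in ds by rewrite mem_small_divisors //= dvd1n exp1n k0.
have l0 : 0 < l by rewrite /l; case: (ds) ds1.
have hP j : j < l -> ram s (P + 2 * j) = nth 0 ds j /\ ram s (P + (2 * j + 1)) = k %/ nth 0 ds j.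
  by move=> jl; rewrite addnA; have := hst j; rewrite size_map (nth_map 0) // => /(_ jl).
have last1 : 0 < last 0 ds by exact: le_last_sorted sd ds1.
have lastk : last 0 ds <= k.
  have : last 0 ds \in ds by case: (ds) ds1 => // x s1 _; exact: mem_last.
  by rewrite mem_small_divisors // => /andP [_]; apply: dvdn_leq.
have hl : l = size ds by [].
have W0 : 0 < W by lia.
have W1 : 1 < W by lia.
have W2 : 2 < W by lia.
clearbody l; rewrite /algA; wsteps.
apply: (wp_for EW (a:=0) (b:=k) (I := fun i s1 t => [/\ reg s1 rI = i,
   forall x, ram s1 x = (if a0 <= x < a0 + i then 0 else ram s x) & t <= 20 * i])) => //=.
- by split=> // x; case: ifP => //; lia.
- move=> i s1 t hi fr [h1 h2 h3]; wreg fr rLEN; wreg fr rA; split.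
  + side.
  + lia.
  + wsteps; split; [lia | | lia].
    move=> x; rewrite /upd h2 erA h1 -/a0; case: (eqVneq x (a0 + i)) => ex; last first.
      by congr (if _ then _ else _); lia.
    by case: ifP => //; lia.
move=> s1 t1 fr1 [h1 hram1 h3]; wreg fr1 rLEN; split; [side | lia | ].
have hPw (s2 : state) j : (forall x, (x < a0) || (a0 + k <= x) -> ram s2 x = ram s x) -> j < l ->
    ram s2 (P + 2 * j) = nth 0 ds j /\ ram s2 (P + (2 * j + 1)) = k %/ nth 0 ds j.
  move=> h jl; have [e1 e2] := hP j jl; have [g1 g2] := disjoint_list_cell hdis jl.
  by split; [rewrite -e1|rewrite -e2]; apply: h.
wsteps.
apply: (wp_for EW (a:=1) (b:=last 0 ds) (I := fun i s2 t => [/\ reg s2 rI = i,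
   reg s2 rK = count (fun d => d < i) ds,
   forall x, (x < a0) || (a0 + k <= x) -> ram s2 x = ram s x,
   forall x, x < k -> ram s2 (a0 + x) = marked pred0 (rowA k) i 0 x :> nat &
   t <= \sum_(1 <= i' < i) (90 + 40 * (k %/ i'))])) => //=.
- wreg fr1 rK; split=> //; usimp.
  + rewrite erK; symmetry; apply/eqP; rewrite -leqn0 leqNgt -has_count; apply/hasPn => d.
    rewrite mem_small_divisors // => /andP [_ /dvdn_gt0]; lia.
  + by move=> x hx; rewrite hram1; case: ifP => //; lia.
  + move=> x hx; rewrite hram1 ifT; last lia.
    rewrite /marked /=; case: asboolP => // -[i' [j' [h1' h2' _ _]]]; lia.
- move=> i s2 t /andP [i0 hi] fr [hI hK hout hmk ht]; wreg fr rL; wreg fr rP; wreg fr rA.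
  wreg fr1 rL; wreg fr1 rP; wreg fr1 rA.
  have hasi := least_ge_last sd hi.
  have hasi0 : has (fun d => i <= d) ds by apply: sub_has hasi => d /=; lia.
  have [c1 c2 c3 c4] := least_geP sd hasi.
  have [c5 _ _ _] := least_geP sd hasi0; rewrite -/ds -hl in c5 c1.
  have [eL _] := hPw s2 (l - 1) hout ltac:(by rewrite subn1 ltn_predL).
  have [e0 _] := hPw s2 _ hout c5.
  have [_ e1] := hPw s2 _ hout c1.
  rewrite subn1 {2}hl nth_last -subn1 in eL.
  have ePs : reg s2 rP = P by rewrite erP erP0.
  have eAs : reg s2 rA = a0 by rewrite erA erA0.
  have eLs : reg s2 rL = l by rewrite erL erL0.
  split.
  + side.
  + rewrite ePs eLs eL; lia.
  wsteps.
  apply: (wp_mono (Q := fun s3 t3 => [/\ reg s3 rK = count (fun d => d < i.+1) ds, ram s3 = ram s2 & t3 <= 20])).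
    2: { apply: (wp_if EW); [side | |] => /=; rewrite ePs hI hK e0 => hc; wsteps; split=> //.
      - by rewrite hK (count_ltS sd hasi0) /least_ge; case: (i == _) hc.
      - by rewrite hK (count_ltS sd hasi0) /least_ge; case: (i == _) hc; rewrite // addn0. }
  move=> s3 t3 fr3 [hK3 hram3 ht3]; wreg fr3 rI; wreg fr3 rA; wreg fr3 rP.
  wsteps.
  set D1 := k %/ least_ge ds i.+1.
  (* the row is empty if D1 <= i, hence the maximum *)
  apply: (wp_for EW (a:=i) (b:=maxn i D1) (I := fun j s4 t => [/\ reg s4 rJ = j,
     forall x, (x < a0) || (a0 + k <= x) -> ram s4 x = ram s x,
     forall x, x < k -> ram s4 (a0 + x) = marked pred0 (rowA k) i j x :> nat &
     t <= 40 * (j - i)])) => //=.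
  + exact: leq_maxl.
  + split=> //; usimp; [lia | by rewrite hram3 | ].
    move=> x hx; rewrite hram3 hmk // [in RHS]marked_row_start //.
    by move=> j' /andP [].
  + move=> j s4 t4 hj fr4 [hJ4 hout4 hmk4 ht4]; wreg fr4 rI; wreg fr4 rA; wreg fr4 rP; wreg fr4 rK.
    have [_ e4] := hPw s4 _ hout4 c1.
    rewrite -/ds in e4.
    have jD : j < D1 by lia.
    have jk : j < k by apply: (leq_trans jD); exact: leq_div.
    have ijk : i * j < k.
      have h1' : least_ge ds i.+1 * D1 <= k by rewrite mulnC leq_trunc_div.
      apply: leq_trans h1'; apply: ltn_mul => //.
    have eK4 : reg s4 rK = count (fun d => d < i.+1) ds by rewrite erK hK3.
    have eP4 : reg s4 rP = P by rewrite erP2 erP1 ePs.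
    have eA4 : reg s4 rA = a0 by rewrite erA2 erA1 eAs.
    have eI4 : reg s4 rI = i by rewrite erI0 erI hI.
    split; [side | rewrite eP4 eK4 e4 hJ4; move: jD; rewrite /D1 /least_ge; lia | ].
    wsteps.
    have ni : reg s4 rI * reg s4 rJ = i * j by rewrite eI4 hJ4.
    split=> //; [lia | | | lia].
    * by move=> x hx; rewrite /upd eA4 ni; case: eqP => [|_]; [lia | exact: hout4].
    * move=> x hx; rewrite /upd eA4 marked_cell //; last first.
        by rewrite /rowA -/ds -/D1; lia.
      rewrite eqn_add2l ni.
      by case: eqP => // _; rewrite hmk4.
  move=> s4 t4 fr4 [hJ4 hout4 hmk4 ht4]; wreg fr4 rI; wreg fr4 rA; wreg fr4 rP; wreg fr4 rK.
  have [_ e4] := hPw s4 _ hout4 c1.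
  have eK4 : reg s4 rK = count (fun d => d < i.+1) ds by rewrite erK hK3.
  have eP4 : reg s4 rP = P by rewrite erP2 erP1 ePs.
    have eA4 : reg s4 rA = a0 by rewrite erA2 erA1 eAs.
    have eI4 : reg s4 rI = i by rewrite erI0 erI hI.
  split; [side | rewrite eP4 eK4 e4 hJ4; rewrite /D1 /least_ge; lia | ].
  wsteps; split=> //; [lia | |].
  * move=> x hx; rewrite hmk4 // marked_row_end // => j' /andP [_]; rewrite -/ds -/D1; lia.
  * rewrite big_nat_recr //=.
    have : D1 <= k %/ i by apply: leq_div2l; [exact: i0 | exact: ltnW].
    lia.
move=> s2 t2 fr2 [hI hK hout hmk ht2]; wreg fr2 rL; wreg fr2 rP; wreg fr2 rA.
wreg fr1 rL; wreg fr1 rP; wreg fr1 rA; wreg fr2 rLEN.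
have [eL _] := hPw s2 (l - 1) hout ltac:(by rewrite subn1 ltn_predL).
rewrite subn1 {2}hl nth_last -subn1 in eL.
have ePs : reg s2 rP = P by rewrite erP erP0.
  have eAs : reg s2 rA = a0 by rewrite erA erA0.
  have eLs : reg s2 rL = l by rewrite erL erL0.
split; [side | rewrite ePs eLs eL; lia | ].
have hfin x : x < k -> ram s2 (a0 + x) = delta_bit k x.
  move=> hx; rewrite hmk //; congr nat_of_bool; rewrite /marked /=.
  apply/asboolP/(delta_bit_rowsA x k0).
    case=> i' [j' [h1' h2' h3' h4']]; exists i', j'; split=> //.
    by rewrite h1' /=; move: h2'; rewrite andbF orbF.
  by case=> i' [j' [/andP [h1' h1''] h2' h3']]; exists i', j'; split=> //; rewrite h1''.
wsteps.
apply: (wp_for EW (a:=0) (b:=k) (I := fun i s3 t => [/\ reg s3 rI = i,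
   reg s3 rW = \sum_(0 <= x < i) delta_bit k x, ram s3 = ram s2 & t <= 20 * i])) => //=.
- by rewrite big_geq.
- move=> i s3 t hi fr3 [hI3 hW3 hram3 ht3]; wreg fr3 rA; wreg fr3 rLEN.
  have hbnd : \sum_(0 <= x < i) delta_bit k x <= i.
    rewrite -{2}[i]subn0 -[X in _ <= X]muln1 -sum_nat_const_nat.
    by apply: leq_sum => x _; exact: leq_b1.
  have ebit : ram s3 (reg s3 rA + reg s3 rI) = delta_bit k i.
    by rewrite hram3 erA1 eAs hI3 hfin //; lia.
  have hb := leq_b1 (delta_bit k i).
  split; [side | lia | ].
  wsteps; split=> //; [lia | | lia].
  by rewrite ebit hW3 big_nat_recr.
move=> s3 t3 fr3 [hI3 hW3 hram3 ht3]; wreg fr3 rLEN.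
split; [side | lia | wsteps].
split=> //.
- by rewrite hW3 delta_sum // big_mkord.
- by move=> x hx; rewrite hram3 hfin.
- by move=> x hx; rewrite hram3 hout.
have hk := quot_sum_ge k0.
have : \sum_(1 <= i' < last 0 ds) (90 + 40 * (k %/ i')) <= 90 * k + 40 * quot_sum k.
  rewrite big_split /= sum_nat_const_nat -big_distrr /= /quot_sum.
  have -> : \sum_(1 <= i < k.+1) k %/ i =
     \sum_(1 <= i < last 0 ds) k %/ i + \sum_(last 0 ds <= i < k.+1) k %/ i.
    by apply: big_cat_nat => //; exact: leqW.
  lia.
lia.
Qed.
End Algs.

Lemma sum_set1 N x (f : pred nat) : x < N -> ~~ f x ->
  \sum_(t < N) ((val t == x) || f t : nat) = \sum_(t < N) (f t : nat) + 1.
Proof.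
move=> xN fx; rewrite (bigD1 (Ordinal xN)) //= eqxx [in RHS](bigD1 (Ordinal xN)) //=.
rewrite (negbTE fx) add0n addn1 add1n; congr S; apply: eq_bigr => t tx.
by case: eqP => // e; case/eqP: tx; apply: val_inj.
Qed.

Section Algs.
Variables (w W : nat).
Hypothesis EW : word_bound w W.

(** * Algorithm B *)

(** The columns that row [i] of [m * q] has beyond row [i] of [m * p]. *)
Definition rowB (m p q i j : nat) : bool :=
  (m * p) %/ least_ge (divisors m) i.+1 <= j < (m * q) %/ least_ge (divisors m) i.+1.

(** The rows of [m * p] and [m * q] are bounded through the same divisors of [m],
    so only the columns of [rowB] are missing.  As [d] divides [m], there are
    [(m / d) * (q - p)] of them in a row. *)
Lemma algB_wp s m p q : inputB w s m p q ->
  reg s rW = delta (m * p) ->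
  (forall t, t < m * q -> ram s (reg s rA + t) = delta_bit (m * p) t) ->
  wp w algB s (fun s' t =>
    [/\ reg s' rW = delta (m * q),
        forall t, t < m * q -> ram s' (reg s rA + t) = delta_bit (m * q) t,
        forall x, (x < reg s rA) || (reg s rA + m * q <= x) -> ram s' x = ram s x &
        t <= 500 * (m + (q - p) * quot_sum m)]).
Proof.
case=> [[m0 pp pq ltpq /andP [pm qm]] hL [hst hst'] [hdis hdis'] [hb1 hb2 hb3]] hW0 hvec.
rewrite -?EW in hb1 hb2 hb3; move: hL hst hst' hdis hdis' hb1 hb2.
have sd := sorted_divisors_ltn m.
move: (sd); set ds := divisors m => _.
set l := size ds => hL hst hst' hdis hdis' hb1 hb2.
set a0 := reg s rA; set P := reg s rP; set P' := reg s rQ; set N := m * q.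
rewrite -/a0 -/P -/P' -/N in hdis hb1 hb2 hst hdis' hst' hb3 hvec.
have pmq : m * p <= N by rewrite leq_mul2l ltnW ?orbT.
have p0 := prime_gt0 pp; have mp0 : 0 < m * p by rewrite muln_gt0 m0.
have N0 : 0 < N := leq_trans mp0 pmq.
have dsm : m \in ds by exact: divisors_id.
have l0 : 0 < l by rewrite /l; case: (ds) dsm.
have lastm : last 0 ds = m by exact: last_divisors.
have hP j : j < l -> [/\ ram s (P + 2 * j) = nth 0 ds j,
     ram s (P + (2 * j + 1)) = (m * p) %/ nth 0 ds j &
     ram s (P' + (2 * j + 1)) = N %/ nth 0 ds j].
  move=> jl; rewrite (addnA P (2 * j) 1) (addnA P' (2 * j) 1).
  have jlp : j < size (cofactor_list m p) by rewrite size_map.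
  have jlq : j < size (cofactor_list m q) by rewrite size_map.
  have [-> ->] := hst j jlp; have [_ ->] := hst' j jlq.
  by rewrite /cofactor_list !(nth_map 0).
have hl : l = size ds by [].

have mN : m <= N by rewrite leq_pmulr // prime_gt0.
have W0 : 0 < W by lia.
have W1 : 1 < W by lia.
have W2 : 2 < W by lia.
have hPw (s2 : state) j : (forall x, (x < a0) || (a0 + N <= x) -> ram s2 x = ram s x) -> j < l ->
    [/\ ram s2 (P + 2 * j) = nth 0 ds j,
     ram s2 (P + (2 * j + 1)) = (m * p) %/ nth 0 ds j &
     ram s2 (P' + (2 * j + 1)) = N %/ nth 0 ds j].
  move=> h jl; have [e1 e2 e3] := hP j jl.
  have [g1 g2] := disjoint_list_cell hdis jl; have [_ g3] := disjoint_list_cell hdis' jl.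
  by split; [rewrite -e1|rewrite -e2|rewrite -e3]; apply: h.
clearbody l; rewrite /algB; wsteps.
pose mk i j (t : nat) := marked (delta_bit (m * p)) (rowB m p q) i j t.
have mk_le i j : \sum_(t < N) (mk i j t : nat) <= N.
  rewrite -[X in _ <= X](card_ord N) -sum1_card; apply: leq_sum => t _; exact: leq_b1.
apply: (wp_for EW (a:=1) (b:=m) (I := fun i s2 t => [/\ reg s2 rI = i /\
   reg s2 rK = count (fun d => d < i) ds,
   forall x, (x < a0) || (a0 + N <= x) -> ram s2 x = ram s x,
   forall x, x < N -> ram s2 (a0 + x) = mk i 0 x,
   reg s2 rW = \sum_(t < N) (mk i 0 t : nat) &
   t <= \sum_(1 <= i' < i) (90 + 60 * ((q - p) * (m %/ i')))])) => //=.
- have mk1 x : mk 1 0 x = delta_bit (m * p) x.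
    rewrite /mk /marked; case: asboolP => [[i' [j' [h1' h2' _ _]]]|]; [lia | by rewrite orbF].
  split=> //; usimp.
  + split=> //; symmetry; apply/eqP; rewrite -leqn0 leqNgt -has_count; apply/hasPn => d.
    rewrite -dvdn_divisors // => /dvdn_gt0; lia.
  + by move=> x hx; rewrite hvec // mk1.
  + rewrite hW0 delta_sum // (eq_bigr (fun t : 'I_N => delta_bit (m * p) t : nat)) => [|t _]; last by rewrite mk1.
    rewrite -(big_mkord xpredT (fun t => delta_bit (m * p) t : nat)).
    rewrite -(big_mkord xpredT (fun t => delta_bit (m * p) t : nat)).
    rewrite [in RHS](@big_cat_nat _ _ _ (m * p)) //=.
    rewrite [X in _ = _ + X]big_nat_cond [X in _ = _ + X]big1 ?addn0 //.
    move=> t /andP [/andP [h1 h2] _]; case: (boolP (delta_bit _ _)) => // /(delta_bit_lt mp0); lia.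
- move=> i s2 t /andP [i0 hi] fr [[hI hK] hout hmk hW ht]; wreg fr rL; wreg fr rP; wreg fr rA; wreg fr rQ.
  have hasi : has (fun d => i.+1 <= d) ds by apply: least_ge_last => //; rewrite lastm.
  have hasi0 : has (fun d => i <= d) ds by apply: sub_has hasi => d /=; lia.
  have [c1 c2 c3 c4] := least_geP sd hasi.
  have [c5 _ _ _] := least_geP sd hasi0; rewrite -/ds -?hl in c5 c1 c2 c3 c4.
  have [eL _ _] := hPw s2 (l - 1) hout ltac:(by rewrite subn1 ltn_predL).
  have [e0 _ _] := hPw s2 _ hout c5.
  rewrite subn1 {2}hl nth_last lastm -subn1 in eL.
  have ePs : reg s2 rP = P by rewrite erP.
  have eQs : reg s2 rQ = P' by rewrite erQ.
  have eAs : reg s2 rA = a0 by rewrite erA.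
  have eLs : reg s2 rL = l by rewrite erL.
  set x := least_ge ds i.+1.
  have xm : x %| m by rewrite dvdn_divisors.
  have x0 : 0 < x := dvdn_gt0 m0 xm.
  pose D1 := (m * p) %/ x; pose D2 := N %/ x.
  have D12 : D1 <= D2 by apply: leq_div2r.
  have D2N : D2 <= N := leq_div _ _.
  (* as functions on unit, the facts with products and quotients stay out of the
     context of lia *)
  have D1D2 (_ : unit) : D2 - D1 <= (q - p) * (m %/ i).
    have xi : m %/ x <= m %/ i by apply: leq_div2l; [exact: i0 | exact: ltnW].
    by rewrite /D1 /D2 /N -!divn_mulAC // -mulnBr mulnC leq_mul2l xi orbT.
  have rowE j' : rowB m p q i j' = (D1 <= j' < D2) by [].
  have eD1 (_ : unit) : D1 = m * p %/ nth 0 ds (count (fun d => d < i.+1) ds) by [].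
  have eD2 (_ : unit) : D2 = N %/ nth 0 ds (count (fun d => d < i.+1) ds) by [].
  have xD2 (_ : unit) : x * D2 <= N by rewrite mulnC leq_trunc_div.
  have lti : i < x by [].
  clear hW0 hvec pmq mp0 N0 p0 lastm xm pm qm pp pq; clearbody N D1 D2 x a0 P P'.
  split.
  + side.
  + rewrite ePs eLs eL; lia.
  wsteps.
  apply: (wp_mono (Q := fun s3 t3 => [/\ reg s3 rK = count (fun d => d < i.+1) ds, ram s3 = ram s2 & t3 <= 20])).
    2: { apply: (wp_if EW); [side | |] => /=; rewrite ePs hI hK e0 => hc; wsteps; split=> //.
      - by rewrite hK (count_ltS sd hasi0) /least_ge; case: (i == _) hc.
      - by rewrite hK (count_ltS sd hasi0) /least_ge; case: (i == _) hc; rewrite // addn0. }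
  move=> s3 t3 fr3 [hK3 hram3 ht3]; wreg fr3 rI; wreg fr3 rA; wreg fr3 rP; wreg fr3 rQ; wreg fr3 rW.
  have eP3 : reg s3 rP = P by rewrite erP0.
  have eQ3 : reg s3 rQ = P' by rewrite erQ0.
  have eA3 : reg s3 rA = a0 by rewrite erA0.
  have eI3 : reg s3 rI = i by rewrite erI.
  have hout3 y : (y < a0) || (a0 + N <= y) -> ram s3 y = ram s y by rewrite hram3; exact: hout.
  have [_ e3 _] := hPw s3 _ hout3 c1; rewrite -(eD1 tt) in e3.
  wsteps.
  apply: (wp_for EW (a:=D1) (b:=D2) (I := fun j s4 t => [/\ reg s4 rJ = j,
     forall x, (x < a0) || (a0 + N <= x) -> ram s4 x = ram s x,
     forall x, x < N -> ram s4 (a0 + x) = mk i j x,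
     reg s4 rW = \sum_(t < N) (mk i j t : nat) &
     t <= 60 * (j - D1)])) => //=.
  + have mk3 y : mk i D1 y = mk i 0 y.
      by apply: marked_row_start => j'; rewrite rowE // => /andP [].
    split=> //; usimp.
    * by rewrite eP3 hK3 e3.
    * by move=> y hy; rewrite hram3 hmk // mk3.
    * by rewrite erW hW; apply: eq_bigr => y _; rewrite mk3.
  + move=> j s4 t4 /andP [hj1 hj2] fr4 [hJ4 hout4 hmk4 hW4 ht4]; wreg fr4 rI; wreg fr4 rA; wreg fr4 rQ; wreg fr4 rK.
    have [_ _ e4] := hPw s4 _ hout4 c1; rewrite -(eD2 tt) in e4.
    have jN : j < N by lia.
    have ijN : i * j < N.
      by apply: leq_trans (xD2 tt); apply: ltn_mul.
    have eK4 : reg s4 rK = count (fun d => d < i.+1) ds by rewrite erK.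
    have eQ4 : reg s4 rQ = P' by rewrite erQ1.
    have eA4 : reg s4 rA = a0 by rewrite erA1.
    have eI4 : reg s4 rI = i by rewrite erI0.
    have ni : reg s4 rI * reg s4 rJ = i * j by rewrite eI4 hJ4.
    have rij : rowB m p q i j by rewrite rowE // hj1.
    have emk y : mk i j.+1 y = (y == i * j) || mk i j y by exact: marked_cell.
    split; [side | by rewrite eQ4 eK4 e4 hJ4 hj2 | ].
    wsteps.
    apply: (wp_mono (Q := fun s5 t5 => [/\
       forall x, (x < a0) || (a0 + N <= x) -> ram s5 x = ram s x,
       forall x, x < N -> ram s5 (a0 + x) = mk i j.+1 x,
       reg s5 rW = \sum_(t < N) (mk i j.+1 t : nat) & t5 <= 40])).
      2: { apply: (wp_if EW); [side | |] => /=; rewrite eA4 ni hmk4 // => hc.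
        - have nm : ~~ mk i j (i * j) by case: (mk _ _ _) hc.
          have esum := sum_set1 ijN nm.
          have esum' : \sum_(t < N) (mk i j.+1 t : nat) = \sum_(t < N) (mk i j t : nat) + 1.
            by rewrite -esum; apply: eq_bigr => y _; rewrite emk.
          have := mk_le i j.+1; rewrite esum' -hW4 => hle.
          have hWb : reg s4 rW + 1 < W by apply: (leq_ltn_trans hle); clear -hb3; lia.
          clear hle.
          wsteps; split=> //.
          + by move=> y hy; rewrite /upd eA4 ni; case: eqP => [|_]; [lia | exact: hout4].
          + move=> y hy; rewrite /upd eA4 eqn_add2l ni emk; case: eqP => //= _; exact: hmk4.
        - have mt : mk i j (i * j) by case: (mk _ _ _) hc.
          have emk' y : mk i j.+1 y = mk i j y by rewrite emk; case: eqP => // ->; rewrite mt.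
          wsteps; split=> //.
          + by move=> y hy; rewrite hmk4 // emk'.
          + by rewrite hW4; apply: eq_bigr => y _; rewrite emk'. }
    move=> s5 t5 fr5 [hout5 hmk5 hW5 ht5]; wreg fr5 rJ.
    by wsteps; split=> //; [rewrite erJ hJ4 addn1 | lia].
  move=> s4 t4 fr4 [hJ4 hout4 hmk4 hW4 ht4]; wreg fr4 rI; wreg fr4 rA; wreg fr4 rQ; wreg fr4 rK.
  have [_ _ e4] := hPw s4 _ hout4 c1; rewrite -(eD2 tt) in e4.
  have eK4 : reg s4 rK = count (fun d => d < i.+1) ds by rewrite erK.
  have eQ4 : reg s4 rQ = P' by rewrite erQ1.
  have eI4 : reg s4 rI = i by rewrite erI0.
  have emk y : mk i D2 y = mk i.+1 0 y.
    by apply: marked_row_end => j'; rewrite rowE // => /andP [].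
  split; [side | by rewrite eQ4 eK4 e4 hJ4 ltnn | ].
  wsteps; split=> //.
  * by rewrite eI4 addn1 eK4.
  * by move=> y hy; rewrite hmk4 // emk.
  * by rewrite hW4; apply: eq_bigr => y _; rewrite emk.
  * rewrite big_nat_recr //=; move: (D1D2 tt); move: ((q - p) * _) => K; clear -ht ht3 ht4; lia.
move=> s2 t2 fr2 [[hI hK] hout hmk hW ht2]; wreg fr2 rL; wreg fr2 rP; wreg fr2 rA.
have [eL _ _] := hPw s2 (l - 1) hout ltac:(by rewrite subn1 ltn_predL).
rewrite subn1 {2}hl nth_last lastm -subn1 in eL.
have ePs : reg s2 rP = P by rewrite erP.
have eLs : reg s2 rL = l by rewrite erL.
split; [side | rewrite ePs eLs eL; lia | ].
have qm' : ~~ (q %| m) := qm.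
have hfin y : y < N -> mk m 0 y = delta_bit N y.
  move=> hy; rewrite /mk /marked; apply/orP/(delta_bit_rowsB y m0 pq qm) => [[|/asboolP]|].
  - case/(delta_bit_rowsB y m0 pp pm) => i' [j' [h1 /andP [h2 h3] h4]]; exists i', j'; split=> //.
    by rewrite h2 /=; apply: (leq_trans h3); apply: leq_div2r.
  - case=> i' [j' [h1 h2 /andP [h3 h4] h5]]; exists i', j'; split=> //.
      by rewrite h1 /=; move: h2; rewrite andbF orbF.
    rewrite h4 andbT (leq_trans _ h3) //.
    have hi' : i' < last 0 (divisors m) by rewrite -/ds lastm; move: h2; rewrite andbF orbF.
    have [_ c2 c3 _] := least_geP sd (least_ge_last sd hi').
    rewrite divn_gt0; last exact: leq_trans c3.
    rewrite -dvdn_divisors // in c2.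
    by rewrite (leq_trans (dvdn_leq m0 c2)) // leq_pmulr.
  case=> i' [j' [/andP [h1 h1'] /andP [h2 h3] h4]].
  case: (ltnP j' (m * p %/ least_ge (divisors m) i'.+1)) => hj'.
    by left; apply/(delta_bit_rowsB y m0 pp pm); exists i', j'; split=> //; rewrite ?h1 ?h2.
  by right; apply/asboolP; exists i', j'; split=> //; rewrite ?h1' // /rowB hj'.
wsteps; split=> //.
- by rewrite hW delta_sum //; apply: eq_bigr => y _; rewrite hfin.
- by move=> y hy; rewrite hmk // hfin.
have : \sum_(1 <= i' < m) (90 + 60 * ((q - p) * (m %/ i'))) <= 90 * m + 60 * ((q - p) * quot_sum m).
  rewrite big_split /= sum_nat_const_nat -!big_distrr /= /quot_sum big_nat_recr //=.
  apply: leq_add; first by clear; lia.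
  by rewrite !leq_mul2l leq_addr !orbT.
move: (\sum_(1 <= _ < m) _) ((q - p) * quot_sum m) ht2 => C A; clear -m0; lia.
Qed.
End Algs.

(** * Calls of the two algorithms *)

(** The divisors found by trial division up to [r]. *)
Definition divs_upto (r k : nat) : seq nat := [seq d <- iota 1 r | d %| k].

Lemma divs_uptoS r k : divs_upto r.+1 k = if r.+1 %| k then rcons (divs_upto r k) r.+1 else divs_upto r k.
Proof. by rewrite /divs_upto -{1}[r.+1]addn1 iotaD filter_cat /= add1n; case: ifP; rewrite ?cats1 ?cats0. Qed.

Lemma size_divs_upto r k : size (divs_upto r k) <= r.
Proof. by rewrite size_filter (leq_trans (count_size _ _)) ?size_iota. Qed.

Lemma sorted_divs_upto r k : sorted ltn (divs_upto r k).
Proof. by apply: (sorted_filter ltn_trans); exact: iota_ltn_sorted. Qed.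

Lemma mem_divs_upto r k d : d \in divs_upto r k = [&& d %| k, 0 < d & d <= r].
Proof. by rewrite mem_filter mem_iota add1n ltnS. Qed.

Lemma divisors_upto m : 0 < m -> divisors m = divs_upto m m.
Proof.
move=> m0; apply: (irr_sorted_eq ltn_trans ltnn (sorted_divisors_ltn m) (sorted_divs_upto m m)) => d.
rewrite mem_divs_upto -dvdn_divisors //; case: (boolP (d %| m)) => // dm.
by rewrite (dvdn_gt0 m0 dm) dvdn_leq.
Qed.

Lemma small_divisors_upto r k : 0 < k -> r * r <= k < r.+1 * r.+1 ->
  small_divisors k = divs_upto r k.
Proof.
move=> k0 /andP [h1 h2]; apply: (irr_sorted_eq ltn_trans ltnn (sorted_small_divisors k) (sorted_divs_upto r k)) => d.
rewrite mem_divs_upto mem_small_divisors // -mulnn andbC; case: (boolP (d %| k)) => //= dk.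
rewrite (dvdn_gt0 k0 dk) /=; apply/idP/idP => h.
  by rewrite leqNgt; apply/negP => h3; move: (leq_mul h3 h3); rewrite leqNgt (leq_ltn_trans h h2).
exact: leq_trans (leq_mul h h) h1.
Qed.

Lemma ex_isqrt k : exists r, r * r <= k < r.+1 * r.+1.
Proof.
elim: k => [|k [r /andP [h1 h2]]]; first by exists 0.
case: (leqP (r.+1 * r.+1) k.+1) => h; last by exists r; rewrite h (leq_trans h1).
exists r.+1; rewrite h /=; nia.
Qed.

(** [RunB] wants a vector produced by Algorithm A for [m * p], but inside a chain it
    was produced by Algorithm B.  The vector does not depend on where the inputs are
    stored, so it is also the result of a run from this state, which holds the
    divisor list at address 0 and has room for the vector after it. *)
Definition stateA (k : nat) : state :=
  let D := divisor_list k in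
  State (fun x => if x == rLEN then k else if x == rL then size D
                  else if x == rA then 2 * size D else 0)
        (fun a => if odd a then (nth (0, 0) D a./2).2 else (nth (0, 0) D a./2).1)
        [::] [::].

Lemma size_divisor_list k : 0 < k -> size (divisor_list k) <= k.
Proof.
move=> k0; rewrite divisor_listE size_map size_filter (leq_trans (count_size _ _)) //.
by rewrite divisors_upto // size_divs_upto.
Qed.

Lemma inputA_stateA w k : 0 < k -> 3 * k < 2 ^ w -> inputA w (stateA k) k.
Proof.
move=> k0 kw; have hs := size_divisor_list k0; split=> //=.
- move=> j jl /=; rewrite !add0n mul2n odd_double doubleK addn1 /= odd_double /=.
  by rewrite uphalf_double.
- by left.
- split; lia.
Qed.

Section Calls.
Variables (w W : nat).
Hypothesis EW : word_bound w W.

Lemma runA_wp s k : inputA w s k ->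
  wp w RunA s (fun s' t =>
    [/\ reg s' rW = delta k,
        forall t, t < k -> ram s' (reg s rA + t) = delta_bit k t,
        forall x, (x < reg s rA) || (reg s rA + k <= x) -> ram s' x = ram s x,
        log s' = rcons (log s) (k, delta k) &
        t <= (500 * quot_sum k).+1]).
Proof.
move=> hin; have [s' [t [ex [h1 h2 h3 h4]]]] := algA_wp EW hin.
exists (record_call s' k (reg s' rW)), t.+1; split; first exact: ExecRunA.
have [_ _ fl] := exec_frame ex; split=> //=.
by rewrite fl // h1.
Qed.

Lemma runB_wp s m p q : inputB w s m p q -> 3 * (m * p) < W ->
  reg s rW = delta (m * p) ->
  (forall t, t < m * q -> ram s (reg s rA + t) = delta_bit (m * p) t) ->
  wp w RunB s (fun s' t =>
    [/\ reg s' rW = delta (m * q),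
        forall t, t < m * q -> ram s' (reg s rA + t) = delta_bit (m * q) t,
        forall x, (x < reg s rA) || (reg s rA + m * q <= x) -> ram s' x = ram s x,
        log s' = rcons (log s) (m * q, delta (m * q)) &
        t <= (500 * (m + (q - p) * quot_sum m)).+1]).
Proof.
move=> hin hb hW hv; have [s' [t [ex [h1 h2 h3 h4]]]] := algB_wp EW hin hW hv.
have [[m0 pp pq ltpq _] _ _ _ _] := hin.
have mp0 : 0 < m * p by rewrite muln_gt0 m0 prime_gt0.
rewrite EW in hb; have hA := inputA_stateA mp0 hb.
have [sA [tA [exA [a1 a2 _ _]]]] := algA_wp EW hA.
exists (record_call s' (m * q) (reg s' rW)), t.+1; split.
  apply: (ExecRunB hA exA hin) => //; split; first by rewrite hW a1.
  move=> u hu; rewrite hv //; case: ltnP => hup; first by rewrite a2.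
  by case: (boolP (delta_bit _ _)) => // /(delta_bit_lt mp0); lia.
have [_ _ fl] := exec_frame ex; split=> //=.
by rewrite fl // h1.
Qed.
End Calls.

(** Registers of the program: [rS] is n + 1, [rG] and [rD] are the bases of the
    tables of largest prime factors and of the values of delta, [rM] is the cofactor
    m, [rU] the prime q, [rB] the prime of the last vector of the chain (0 if there
    is none), and [rF] the largest prime factor of m.  The sieve and the
    output loop reuse [rM] and [rU] as counters. *)
Definition rS := 10.
Definition rG := 11.
Definition rD := 12.
Definition rM := 13.
Definition rU := 14.
Definition rB := 15.
Definition rF := 16.
Definition rC := 17.
Definition rLim := 18.
Definition rX := 19.

(** With S = n + 1 cells for each table and 2 S for each list: the bit vector starts
    at 0, the lists at S and 3 S, the largest prime factors at 5 S, the values of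
    delta at 6 S. *)
Definition layout (n : nat) (s : state) : Prop :=
  [/\ reg s rIN = n, reg s rS = n.+1, reg s rA = 0 &
   [/\ reg s rP = n.+1, reg s rQ = 3 * n.+1, reg s rG = 5 * n.+1 & reg s rD = 6 * n.+1]].

Lemma frame_layout n c s s' : frame c s s' ->
  ~~ has (mem (wregs c)) [:: rIN; rS; rA; rP; rQ; rG; rD] ->
  layout n s -> layout n s'.
Proof.
move=> [fr _ _] /= h [h1 h2 h3 [h4 h5 h6 h7]].
move: h; rewrite !negb_or => /and5P [g1 g2 g3 g4 /and4P [g5 g6 g7 _]].
by split; [| | | split]; rewrite fr.
Qed.

Definition callA : cmd := seqs [::
  Assign rL (Cst 0);
  Assign rC (Cst 1);
  While (Op Lt (Op Mul (Reg rC) (Reg rC)) (Op Add (Reg rLEN) (Cst 1))) (seqs [::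
    If (Op Eq (Op Mod (Reg rLEN) (Reg rC)) (Cst 0))
      (seqs [:: put rP (Reg rC) (Op Div (Reg rLEN) (Reg rC)); incr rL])
      Skip;
    incr rC]);
  RunA].

Definition callB : cmd := seqs [::
  Assign rL (Cst 0);
  Assign rC (Cst 1);
  While (Op Lt (Reg rC) (Op Add (Reg rM) (Cst 1))) (seqs [::
    If (Op Eq (Op Mod (Reg rM) (Reg rC)) (Cst 0))
      (seqs [:: put rP (Reg rC) (Op Div (Op Mul (Reg rM) (Reg rB)) (Reg rC));
                put rQ (Reg rC) (Op Div (Reg rLEN) (Reg rC)); incr rL])
      Skip;
    incr rC]);
  Assign rC (Op Mul (Reg rM) (Reg rB));
  While (Op Lt (Reg rC) (Reg rLEN)) (seqs [::
    Store (Op Add (Reg rA) (Reg rC)) (Cst 0);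
    incr rC]);
  RunB].

(** A list of pairs [(d, f d)] laid out as a divisor list. *)
Definition lists_at (L : seq nat) (f : nat -> nat) (base : nat) (s : state) : Prop :=
  forall j, j < size L ->
    ram s (base + 2 * j) = nth 0 L j /\ ram s (base + (2 * j + 1)) = f (nth 0 L j).

Lemma lists_at_rcons L f base s s' d : lists_at L f base s ->
  ram s' (base + 2 * size L) = d -> ram s' (base + (2 * size L + 1)) = f d ->
  (forall x, base <= x < base + 2 * size L -> ram s' x = ram s x) ->
  lists_at (rcons L d) f base s'.
Proof.
move=> h h1 h2 hx j; rewrite size_rcons ltnS leq_eqVlt => /orP [/eqP ->|jl].
  by rewrite nth_rcons ltnn eqxx.
have [e1 e2] := h j jl; rewrite nth_rcons jl.
by split; [rewrite -e1|rewrite -e2]; apply: hx; lia.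
Qed.

Lemma lists_at_stores L f base s : lists_at L f base s -> stores_list s base [seq (d, f d) | d <- L].
Proof.
move=> h j; rewrite size_map => jl; rewrite (nth_map 0) //= -addnA; exact: h.
Qed.

Section Calls.
Variables (w W n : nat).
Hypothesis EW : word_bound w W.
Hypothesis hW : 256 * (n.+1 * n.+1) <= W.

Lemma word_linear : 100 * n.+1 < W.
Proof. by apply: (leq_trans _ hW); nia. Qed.

(** Trial division up to the square root costs less than Algorithm A itself. *)
Lemma callA_wp s k : layout n s -> 0 < k <= n -> reg s rLEN = k ->
  wp w callA s (fun s' t =>
    [/\ reg s' rW = delta k,
        forall t, t < k -> ram s' t = delta_bit k t,
        forall x, 3 * n.+1 <= x -> ram s' x = ram s x,
        log s' = rcons (log s) (k, delta k) &
        t <= 700 * quot_sum k]).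
Proof.
move=> lay /andP [k0 kn] hLEN; have lW := word_linear.
have W0 : 0 < W by lia. have W1 : 1 < W by lia. have W2 : 2 < W by lia.
have [r hr] := ex_isqrt k.
have rk : r <= k by case/andP: hr => + _; case: (r) => // r'; nia.
case: (lay) => [l1 l2 l3 [l4 l5 l6 l7]].
rewrite /callA; wsteps.
apply: (wp_for EW (a:=0) (b:=r) (I := fun i s1 t => [/\ reg s1 rC = i.+1,
   reg s1 rL = size (divs_upto i k), lists_at (divs_upto i k) (fun d => k %/ d) n.+1 s1,
   forall x, 3 * n.+1 <= x -> ram s1 x = ram s x & t <= 80 * i])) => //=.
- move=> i s1 t hi fr [hC hL hst hout ht]; wreg fr rLEN.
  have lay1 : layout n s1 by apply: (frame_layout fr isT).
  case: (lay1) => [a1 a2 a3 [a4 a5 a6 a7]].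
  have sz := size_divs_upto i k.
  have sqk : i.+1 * i.+1 <= k by case/andP: hr => + _; apply: leq_trans; apply: leq_mul.
  have sqW : reg s1 rC * reg s1 rC < W by rewrite hC (leq_ltn_trans sqk) //; clear -kn lW; lia.
  clear hr; split; [side | | ].
    by rewrite hC erLEN hLEN addn1 ltnS sqk.
  wsteps.
  apply: (wp_mono (Q := fun s2 t2 => [/\ reg s2 rL = size (divs_upto i.+1 k),
     lists_at (divs_upto i.+1 k) (fun d => k %/ d) n.+1 s2,
     forall x, 3 * n.+1 <= x -> ram s2 x = ram s x & t2 <= 50])).
    2: { apply: (wp_if EW); [side | |] => /=; rewrite divs_uptoS /dvdn erLEN hLEN hC => hc.
      - have -> : (k %% i.+1 == 0) by case: (_ %% _ == 0) hc.
        rewrite size_rcons.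
        clear hc sqk; wsteps; split=> //.
        + by rewrite hL addn1.
        + apply: (lists_at_rcons hst) => /=; rewrite /upd a4 hL hC erLEN hLEN ?eqxx //.
          * by rewrite ifF //; apply/negbTE/eqP; lia.
          * by move=> x hx; rewrite !ifF //; apply/negbTE/eqP; lia.
        + by move=> x hx; rewrite /upd a4 hL !ifF ?hout //; apply/negbTE/eqP; lia.
      - have -> : (k %% i.+1 == 0) = false by case: (_ %% _ == 0) hc.
        by clear hc; wsteps; split. }
  move=> s2 t2 fr2 [hL2 hst2 hout2 ht2]; wreg fr2 rC.
  wsteps; split=> //; [by rewrite erC hC addn1 | lia].
move=> s1 t1 fr1 [hC hL hst hout ht]; wreg fr1 rLEN.
have lay1 : layout n s1 by apply: (frame_layout fr1 isT).
case: (lay1) => [a1 a2 a3 [a4 a5 a6 a7]].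
have sqr : r.+1 * r.+1 <= n.+1 * n.+1 by apply: leq_mul; lia.
have sqW : reg s1 rC * reg s1 rC < W.
  by rewrite hC (leq_ltn_trans sqr) // (leq_trans _ hW) //; clear; lia.
split; [side | | ].
  by rewrite hC erLEN hLEN addn1 ltnS leqNgt; case/andP: hr => _ ->.
wsteps.
have hin : inputA w s1 k.
  split=> //.
  - by rewrite erLEN hLEN hL divisor_listE size_map (small_divisors_upto k0 hr).
  - by rewrite divisor_listE (small_divisors_upto k0 hr) a4; exact: lists_at_stores.
  - by right; rewrite a3 a4; lia.
  - rewrite -EW a3 a4; have := size_divisor_list k0; lia.
apply: wp_mono (runA_wp EW hin) => s2 t2 fr2 [h1 h2 h3 h4 h5].
wsteps; split=> //.
- by move=> t ht'; have := h2 t ht'; rewrite a3.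
- move=> x hx; rewrite h3 ?hout // a3; apply/orP; right; lia.
- have [_ _ fl] := fr1; by rewrite h4 fl.
- have := quot_sum_ge k0; clear -rk ht h5 k0; move: (quot_sum k) h5 => A; lia.
Qed.

(** Everything around Algorithm B, in particular clearing the cells between
    [m * p] and [m * q], is dominated by [(q - p) * quot_sum m]. *)
Lemma callB_wp s m p q : layout n s -> 0 < m -> m * q <= n ->
  prime p -> prime q -> p < q -> ~~ (p %| m) -> ~~ (q %| m) ->
  reg s rM = m -> reg s rB = p -> reg s rLEN = m * q ->
  reg s rW = delta (m * p) -> (forall t, t < m * p -> ram s t = delta_bit (m * p) t) ->
  wp w callB s (fun s' t =>
    [/\ reg s' rW = delta (m * q),
        forall t, t < m * q -> ram s' t = delta_bit (m * q) t,
        forall x, 5 * n.+1 <= x -> ram s' x = ram s x,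
        log s' = rcons (log s) (m * q, delta (m * q)) &
        t <= 1500 * ((q - p) * quot_sum m)]).
Proof.
move=> lay m0 mqn pp pq ltpq npm nqm hM hB hLEN hW0 hvec; have lW := word_linear.
have W0 : 0 < W by lia. have W1 : 1 < W by lia. have W2 : 2 < W by lia.
case: (lay) => [l1 l2 l3 [l4 l5 l6 l7]].
have mpq : m * p <= m * q by rewrite leq_mul2l ltnW ?orbT.
have mn : m <= n by apply: (leq_trans _ mqn); rewrite leq_pmulr // prime_gt0.
have mp0 : 0 < m * p by rewrite muln_gt0 m0 prime_gt0.
have mpn : m * p <= n := leq_trans mpq mqn.
rewrite /callB; wsteps.
apply: (wp_for EW (a:=0) (b:=m) (I := fun i s1 t => [/\ reg s1 rC = i.+1,
   reg s1 rL = size (divs_upto i m),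
   lists_at (divs_upto i m) (fun d => (m * p) %/ d) n.+1 s1 /\
   lists_at (divs_upto i m) (fun d => (m * q) %/ d) (3 * n.+1) s1,
   forall x, (x < n.+1) || (5 * n.+1 <= x) -> ram s1 x = ram s x & t <= 140 * i])) => //=.
- clear npm nqm pp pq.
  move=> i s1 t hi fr [hC hL [hst hst'] hout ht]; wreg fr rLEN; wreg fr rM; wreg fr rB.
  have lay1 : layout n s1 by apply: (frame_layout fr isT).
  case: (lay1) => [a1 a2 a3 [a4 a5 a6 a7]].
  have sz := size_divs_upto i m.
  have emp : reg s1 rM * reg s1 rB = m * p by rewrite erM erB hM hB.
  have mW : reg s1 rM * reg s1 rB < W by rewrite emp; clear -mpn lW; lia.
  have LW : reg s1 rLEN < W by rewrite erLEN hLEN; clear -mqn lW; lia.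
  have MW : reg s1 rM < W by rewrite erM hM; clear -mn lW; lia.
  move: (m * p) (m * q) emp mpq mpn mqn hW0 hvec hLEN hst hst' mp0 => mp mq emp mpq mpn mqn hW0 hvec hLEN hst hst' mp0.
  split; [side | by rewrite hC erM hM addn1 !ltnS hi | ].
  wsteps.
  apply: (wp_mono (Q := fun s2 t2 => [/\ reg s2 rL = size (divs_upto i.+1 m),
     lists_at (divs_upto i.+1 m) (fun d => mp %/ d) n.+1 s2 /\
     lists_at (divs_upto i.+1 m) (fun d => mq %/ d) (3 * n.+1) s2,
     forall x, (x < n.+1) || (5 * n.+1 <= x) -> ram s2 x = ram s x & t2 <= 100])).
    2: { apply: (wp_if EW); [side | |] => /=; rewrite divs_uptoS /dvdn erM hM hC => hc.
      - have -> : (m %% i.+1 == 0) by case: (_ %% _ == 0) hc.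
        rewrite size_rcons.
        clear hc; wsteps; split=> //.
        + by rewrite hL addn1.
        + split.
          * apply: (lists_at_rcons hst) => /=; rewrite /upd ?a4 ?a5 hL hC emp erLEN hLEN ?eqxx //.
            -- by rewrite !ifF //; apply/negbTE/eqP; lia.
            -- by rewrite !ifF //; apply/negbTE/eqP; lia.
            -- by move=> x hx; rewrite !ifF //; apply/negbTE/eqP; lia.
          * apply: (lists_at_rcons hst') => /=; rewrite /upd ?a4 ?a5 hL hC emp erLEN hLEN ?eqxx //.
            -- by rewrite !ifF //; apply/negbTE/eqP; lia.
            -- by move=> x hx; rewrite !ifF //; apply/negbTE/eqP; lia.
        + by move=> x hx; rewrite /upd a4 a5 hL !ifF ?hout //; apply/negbTE/eqP; lia.
      - have -> : (m %% i.+1 == 0) = false by case: (_ %% _ == 0) hc.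
        by clear hc; wsteps; split. }
  move=> s2 t2 fr2 [hL2 hst2 hout2 ht2]; wreg fr2 rC.
  wsteps; split=> //; [by rewrite erC hC addn1 | lia].
move=> s1 t1 fr1 [hC hL [hst hst'] hout ht]; wreg fr1 rLEN; wreg fr1 rM; wreg fr1 rB; wreg fr1 rW.
have lay1 : layout n s1 by apply: (frame_layout fr1 isT).
case: (lay1) => [a1 a2 a3 [a4 a5 a6 a7]].
have emp : reg s1 rM * reg s1 rB = m * p by rewrite erM erB hM hB.
have mW : reg s1 rM * reg s1 rB < W by rewrite emp; clear -mpn lW; lia.
have MW : reg s1 rM + 1 < W by rewrite erM hM; clear -mn lW; lia.
split; [by side | by rewrite hC erM hM addn1 ltnn | ].
wsteps.
apply: (wp_for EW (a:=m * p) (b:=m * q) (I := fun i s2 t => [/\ reg s2 rC = i,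
   forall x, ram s2 x = (if m * p <= x < i then 0 else ram s1 x) & t <= 30 * (i - m * p)])) => //=.
- split=> //.
  by move=> x; rewrite ifF //; apply/negP; clear; lia.
- move=> i s2 t /andP [hi1 hi2] fr2 [hC2 hram2 ht2]; wreg fr2 rLEN; wreg fr2 rA.
  have eL2 : reg s2 rLEN = m * q by rewrite erLEN0 erLEN.
  have eA2 : reg s2 rA = 0 by rewrite erA a3.
  have iW : i + 1 < W by clear -hi2 mqn lW; lia.
  have C0W : reg s2 rC + 1 < W by rewrite hC2.
  have CW : reg s2 rA + reg s2 rC < W by rewrite eA2 hC2; clear -iW; lia.
  split; [by side | by rewrite hC2 eL2 hi2 | ].
  wsteps; split=> //; first by rewrite hC2 addn1.
    move=> x; rewrite /upd hram2 eA2 hC2 add0n; clear -hi1.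
    case: (eqVneq x i) => [->|ne]; first by rewrite ifT // hi1 ltnSn.
    by congr (if _ then _ else _); lia.
  by move: ht2; clear -hi1; lia.
move=> s2 t2 fr2 [hC2 hram2 ht2]; wreg fr2 rLEN; wreg fr2 rM; wreg fr2 rW; wreg fr2 rL.
have lay2 : layout n s2 by apply: (frame_layout fr2 isT).
case: (lay2) => [b1 b2 b3 [b4 b5 b6 b7]].
have eL2 : reg s2 rLEN = m * q by rewrite erLEN0 erLEN.
have hold2 f base : n.+1 <= base -> lists_at (divs_upto m m) f base s1 -> lists_at (divs_upto m m) f base s2.
  move=> hb h j jl; have [<- <-] := h j jl; rewrite !hram2 !ifF //; apply/negP; clear -hb mqn; lia.
split; [by side | by rewrite hC2 eL2 ltnn | ].
wsteps.
have eD := divisors_upto m0.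
have hsz : size (divisors m) <= n by rewrite eD; apply: leq_trans mn; exact: size_divs_upto.
have hin : inputB w s2 m p q.
  split=> //.
  - by rewrite npm nqm.
  - by rewrite erL hL eD.
  - rewrite /cofactor_list eD b4 b5; split; apply: lists_at_stores; apply: hold2 => //; clear; lia.
  - by rewrite b3 b4 b5; split; right; clear -mqn; lia.
  - by rewrite -EW b3 b4 b5; split; clear -hsz mqn lW; lia.
have hv2 t : t < m * q -> ram s2 (reg s2 rA + t) = delta_bit (m * p) t.
  move=> htq; rewrite b3 add0n hram2; case: (leqP (m * p) t) => htp /=.
    by rewrite htq; case: (boolP (delta_bit _ _)) => // /(delta_bit_lt mp0); rewrite ltnNge htp.
  rewrite hout; first exact: hvec.
  by apply/orP; left; clear -htq mqn; lia.
have h3W : 3 * (m * p) < W by clear -mpn lW; lia.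
have hW2 : reg s2 rW = delta (m * p) by rewrite erW0 erW.
apply: wp_mono (runB_wp EW hin h3W hW2 hv2) => s3 t3 fr3 [h1 h2 h3 h4 h5].
wsteps; split=> //.
- by move=> t ht'; have := h2 t ht'; rewrite b3.
- move=> x hx; rewrite h3; last by rewrite b3; apply/orP; right; clear -hx mqn; lia.
  rewrite hram2 ifF; last by apply/negP; clear -hx mqn; lia.
  by apply: hout; rewrite hx orbT.
- have [_ _ fl2] := fr2; have [_ _ fl1] := fr1; by rewrite h4 fl2 // fl1.
- have hm := quot_sum_ge m0.
  have qp : 0 < q - p by rewrite subn_gt0.
  have h6 : m <= (q - p) * quot_sum m by apply: (leq_trans hm); rewrite leq_pmull.
  have h7 : m * q - m * p <= (q - p) * quot_sum m by rewrite -mulnBr mulnC leq_mul2l hm orbT.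
  clear -m0 ht ht2 h5 h6 h7; move: ((q - p) * quot_sum m) (m * q - m * p) h5 h6 h7 ht2 => A B; lia.
Qed.

End Calls.

(** * Largest prime factors and sums of quotients *)

Lemma max_pdiv1 : max_pdiv 1 = 1. Proof. by []. Qed.

Lemma max_pdiv_ge k p : 0 < k -> prime p -> p %| k -> p <= max_pdiv k.
Proof. by move=> k0 pp pk; apply: max_pdiv_max; rewrite mem_primes pp k0. Qed.

Lemma max_pdiv_id_prime q : 1 < q -> max_pdiv q = q -> prime q.
Proof. by move=> q1 <-; exact: max_pdiv_prime. Qed.

Lemma prime_max_pdiv p : prime p -> max_pdiv p = p.
Proof.
move=> pp; have p1 := prime_gt1 pp; apply/eqP.
by rewrite -dvdn_prime2 ?max_pdiv_prime // max_pdiv_dvd.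
Qed.

Lemma max_pdiv_idem k : max_pdiv (max_pdiv k) = max_pdiv k.
Proof.
case: (ltnP 1 k) => [k1|]; first by rewrite prime_max_pdiv // max_pdiv_prime.
by case: k => [|[|]].
Qed.

Lemma max_pdiv_cofactor k : 0 < k -> max_pdiv (k %/ max_pdiv k) <= max_pdiv k.
Proof.
move=> k0; have kd := max_pdiv_dvd k; set m := k %/ max_pdiv k.
case: (ltnP 1 m) => m1; last by apply: leq_trans (max_pdiv_gt0 k); case: (m) m1 => [|[|]].
apply: max_pdiv_ge => //; first exact: max_pdiv_prime.
apply: (dvdn_trans (max_pdiv_dvd m)); apply/dvdnP; exists (max_pdiv k).
by rewrite mulnC /m divnK.
Qed.

(** Each dyadic block of indices contributes at most [k]. *)
Lemma quot_sum_log k : quot_sum k <= k * (trunc_log 2 k).+1.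
Proof.
case: (posnP k) => [->|k0]; first by rewrite /quot_sum big_geq.
have H e : \sum_(1 <= i < 2 ^ e) k %/ i <= k * e.
  elim: e => [|e IH]; first by rewrite big_geq.
  rewrite (@big_cat_nat _ _ _ (2 ^ e)) ?expn_gt0 ?leq_exp2l //=.
  rewrite mulnS addnC leq_add //.
  apply: (@leq_trans (\sum_(2 ^ e <= i < 2 ^ e.+1) k %/ 2 ^ e)).
    rewrite big_nat_cond [leqRHS]big_nat_cond; apply: leq_sum => i /andP [/andP [h _] _].
    by apply: leq_div2l; rewrite ?expn_gt0.
  rewrite sum_nat_const_nat expnS mul2n -addnn addnK mulnC; exact: leq_trunc_div.
apply: leq_trans (H (trunc_log 2 k).+1); rewrite /quot_sum.
have h : k < 2 ^ (trunc_log 2 k).+1 by apply: trunc_log_ltn.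
by rewrite [leqRHS](@big_cat_nat _ _ _ k.+1) //= leq_addr.
Qed.

Definition nlog (n : nat) : nat := n * (trunc_log 2 n).+1.

Lemma quot_sum_le_nlog k n : k <= n -> quot_sum k <= nlog n.
Proof.
move=> kn; apply: leq_trans (quot_sum_log k) _; apply: leq_mul => //; rewrite ltnS.
by apply: leq_trunc_log.
Qed.

Lemma nlog_ge n : n <= nlog n.
Proof. by rewrite /nlog leq_pmulr. Qed.

(** * The sieve *)

Definition sieve : cmd := seqs [::
  Store (Op Add (Reg rG) (Cst 1)) (Cst 1);
  Assign rM (Cst 2);
  While (Op Lt (Reg rM) (Reg rS)) (seqs [::
    If (Op Eq (Mem (Op Add (Reg rG) (Reg rM))) (Cst 0))
      (seqs [::
        Assign rU (Reg rM);
        While (Op Lt (Reg rU) (Reg rS)) (seqs [::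
          Store (Op Add (Reg rG) (Reg rU)) (Reg rM);
          Assign rU (Op Add (Reg rU) (Reg rM))])])
      Skip;
    incr rM])].

(** The entry [g] of [k] when the sieve reaches [p]; 0 means that no prime factor
    has been found yet. *)
Definition sieved (p k g : nat) : Prop :=
  (g = 0 /\ forall r, prime r -> r < p -> ~~ (r %| k)) \/
  [/\ prime g, g < p, g %| k & forall r, prime r -> r < p -> r %| k -> r <= g].

(** An integer without prime factors below itself is prime: the sieve needs no
    primality test. *)
Lemma sieved_prime p : 1 < p -> forall g, sieved p p g -> (g == 0) = prime p.
Proof.
move=> p1 g [[-> h]|[pg gp gd _]].
  rewrite eqxx; symmetry.
  have pp := pdiv_prime p1.
  case: (ltnP (pdiv p) p) => hp; first by have := h _ pp hp; rewrite pdiv_dvd.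
  by rewrite (_ : p = pdiv p) //; apply/eqP; rewrite eqn_leq hp pdiv_leq // ltnW.
have g0 := prime_gt0 pg; rewrite gtn_eqF //; symmetry; apply/negP => pp.
by move: gd gp; rewrite dvdn_prime2 // => /eqP ->; rewrite ltnn.
Qed.

Lemma sieved_mul p k : prime p -> p %| k -> sieved p.+1 k p.
Proof. by move=> pp pk; right; split=> // r _; rewrite ltnS. Qed.

Lemma sieved_other p k g : ~~ (prime p && (p %| k)) -> sieved p k g -> sieved p.+1 k g.
Proof.
move=> hp.
have lt r : prime r -> r < p.+1 -> r %| k -> r < p.
  move=> pr; rewrite ltnS leq_eqVlt => /orP [/eqP er|//] rk.
  by rewrite -er pr rk in hp.
case=> [[-> h]|[pg gp gd h]]; [left; split=> // r pr hr | right; split=> //; last first].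
- by apply/negP => rk; have := h r pr (lt r pr hr rk); rewrite rk.
- by move=> r pr hr rk; apply: h => //; exact: lt.
- exact: ltnW.
Qed.

Lemma sieved_max n k g : 1 < k <= n -> sieved n.+1 k g -> g = max_pdiv k.
Proof.
move=> /andP [k1 kn] hs; have pk := max_pdiv_prime k1; have dk := max_pdiv_dvd k.
have k0 : 0 < k := ltnW k1.
have lek : max_pdiv k < n.+1 by rewrite ltnS (leq_trans (max_pdiv_leq k0)).
case: hs => [[_ h]|[pg gp gd h]]; first by have := h _ pk lek; rewrite dk.
by apply/eqP; rewrite eqn_leq max_pdiv_ge //= h.
Qed.

Section Main.
Variables (w W n : nat).
Hypothesis EW : word_bound w W.
Hypothesis hW : 256 * (n.+1 * n.+1) <= W.
Hypothesis n0 : 0 < n.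

Lemma sieve_wp s : layout n s -> (forall k, k <= n -> ram s (5 * n.+1 + k) = 0) ->
  wp w sieve s (fun s' t =>
    (forall k, 0 < k <= n -> ram s' (5 * n.+1 + k) = max_pdiv k) /\ t <= 200 * nlog n).
Proof.
move=> lay hz; have lW := word_linear hW.
have W0 : 0 < W by lia. have W1 : 1 < W by lia. have W2 : 2 < W by lia.
case: (lay) => [l1 l2 l3 [l4 l5 l6 l7]].
have GW : reg s rG + 1 < W by rewrite l6; clear -lW n0; lia.
rewrite /sieve; wsteps.
apply: (wp_for EW (a:=2) (b:=n.+1) (I := fun p s1 t => [/\ reg s1 rM = p,
   ram s1 (5 * n.+1 + 1) = 1,
   forall k, 1 < k <= n -> sieved p k (ram s1 (5 * n.+1 + k)) &
   t <= \sum_(2 <= i < p) (90 + 40 * (n %/ i))])) => //=.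
- split=> //; usimp; first by rewrite /upd l6 eqxx.
  move=> k /andP [k1 kn]; left; rewrite /upd l6 eqn_add2l gtn_eqF // hz //; split=> // r.
  by move=> /prime_gt1; clear; lia.
- move=> p s1 t /andP [p2 pn] fr [hM h1 hs ht].
  have lay1 : layout n s1 by apply: (frame_layout fr isT).
  case: (lay1) => [a1 a2 a3 [a4 a5 a6 a7]].
  have sp := sieved_prime p2 (hs p ltac:(by rewrite p2 -ltnS pn)).
  split; [side | by rewrite hM a2 pn | ].
  wsteps.
  apply: (wp_mono (Q := fun s2 t2 => [/\ ram s2 (5 * n.+1 + 1) = 1,
   forall k, 1 < k <= n -> sieved p.+1 k (ram s2 (5 * n.+1 + k)) &
   t2 <= 60 + 40 * (n %/ p)])).
    2: { apply: (wp_if EW); [side | |] => /=; rewrite a6 hM => hc.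
      - have pp : prime p by move: hc; rewrite sp; case: (prime p).
        wsteps.
        apply: (wp_for EW (a:=1) (b:=(n %/ p).+1) (I := fun i s2 t => [/\ reg s2 rU = i * p,
          forall k, k <= n -> ram s2 (5 * n.+1 + k) =
             if [&& p %| k, 0 < k & k < i * p] then p else ram s1 (5 * n.+1 + k) & t <= 30 * i])) => //=.
        + split; usimp => //; first by rewrite hM mul1n.
          move=> k kn; rewrite ifF //; apply/negP => /and3P [pk k0]; rewrite mul1n.
          by rewrite ltnNge dvdn_leq.
        + move=> i s2 t2 /andP [i1 hi] fr2 [hU hram2 ht2]; wreg fr2 rM; wreg fr2 rG; wreg fr2 rS.
          have ipn : i * p <= n by rewrite -leq_divRL // ltnW.
          have U2 : reg s2 rU + reg s2 rM < W by rewrite hU erM hM; clear -ipn lW pn; lia.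
          have U1 : reg s2 rG + reg s2 rU < W by rewrite hU erG a6; clear -ipn lW pn; lia.
          split; [by side | by rewrite hU erS a2 ltnS ipn | ].
          wsteps; split.
          * by rewrite hU erM hM mulSn addnC.
          * move=> k kn; rewrite /upd hU erG a6 eqn_add2l erM hM hram2 // mulSn.
            case: (eqVneq k (i * p)) => [->|ne].
              rewrite ifT //; apply/and3P; split; [exact: dvdn_mull | by rewrite muln_gt0 i1 ltnW | ].
              by clear -p2; lia.
            congr (if _ then _ else _); case: (boolP (p %| k)) => //= /dvdnP [j jE].
            rewrite jE; rewrite jE in ne; clear -ne p2 i1.
            congr (_ && _); rewrite !ltn_pmul2r ?(ltnW p2) //.
            have ji : j != i by apply: contra ne => /eqP ->.
            lia.
          * by clear -ht2; lia.
        + move=> s2 t2 fr2 [hU hram2 ht2]; wreg fr2 rM; wreg fr2 rS.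
          have npn : n < (n %/ p).+1 * p by rewrite ltn_ceil // ltnW.
          split; [by side | by rewrite hU erS a2 ltnS leqNgt npn | ].
          wsteps; split.
          * rewrite hram2 // ifF // dvdn1; clear -p2; lia.
          * move=> k /andP [k1 kn]; rewrite hram2 // (leq_ltn_trans kn npn) (ltnW k1) andbT.
            case: (boolP (p %| k)) => pk; first exact: sieved_mul.
            by apply: sieved_other; [rewrite (negbTE pk) andbF | apply: hs; rewrite k1].
          * by clear -ht2; lia.
      - have npp : ~~ prime p by move: hc; rewrite sp; case: (prime p).
        clear hc; wsteps; split=> //.
        by move=> k hk; apply: sieved_other; [rewrite (negbTE npp) | exact: hs]. }
  move=> s2 t2 fr2 [h21 hs2 ht2]; wreg fr2 rM.
  have MW : reg s2 rM + 1 < W by rewrite erM hM; clear -lW pn; lia.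
  wsteps; split=> //; first by rewrite erM hM addn1.
  rewrite big_nat_recr //=; clear -ht ht2; lia.
move=> s1 t1 fr1 [hM h1 hs ht].
have lay1 : layout n s1 by apply: (frame_layout fr1 isT).
case: (lay1) => [a1 a2 a3 [a4 a5 a6 a7]].
split; [by side | by rewrite hM a2 ltnn | ].
wsteps; split.
  move=> k /andP [k0 kn]; case: (ltnP 1 k) => k1; first by apply: sieved_max (hs k _); rewrite ?k1.
  by rewrite (_ : k = 1) ?h1 //; clear -k0 k1; lia.
have hsn : \sum_(2 <= i < n.+1) (90 + 40 * (n %/ i)) <= 90 * n + 40 * quot_sum n.
  rewrite big_split /= sum_nat_const_nat -big_distrr /=; apply: leq_add; first by clear; lia.
  by rewrite leq_mul2l /= /quot_sum [leqRHS]big_ltn // leq_addl.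
have := quot_sum_le_nlog (leqnn n); have := nlog_ge n; clear -ht hsn n0.
move: (quot_sum n) (nlog n) hsn => A B hsn hA hB; lia.
Qed.
End Main.

(** * Chains of calls *)

Definition visit : cmd := seqs [::
  Assign rLEN (Op Mul (Reg rM) (Reg rU));
  If (Op Eq (Reg rB) (Cst 0)) callA callB;
  Store (Op Add (Reg rD) (Reg rLEN)) (Reg rW);
  If (Op Eq (Reg rU) (Reg rF)) (Assign rB (Cst 0)) (Assign rB (Reg rU))].

Definition chain : cmd := seqs [::
  Assign rB (Cst 0);
  Assign rF (Mem (Op Add (Reg rG) (Reg rM)));
  Assign rU (Reg rF);
  Assign rLim (Op Add (Op Div (Reg rIN) (Reg rM)) (Cst 1));
  While (Op Lt (Reg rU) (Reg rLim)) (seqs [::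
    If (Op Eq (Mem (Op Add (Reg rG) (Reg rU))) (Reg rU)) visit Skip;
    incr rU])].

Definition chains : cmd := seqs [::
  Assign rM (Cst 1);
  While (Op Lt (Reg rM) (Reg rS)) (seqs [:: chain; incr rM])].

Section Main.
Variables (w W n : nat).
Hypothesis EW : word_bound w W.
Hypothesis hW : 256 * (n.+1 * n.+1) <= W.
Hypothesis n0 : 0 < n.

Definition prime_table (s : state) : Prop :=
  forall k, 0 < k <= n -> ram s (5 * n.+1 + k) = max_pdiv k.

(** The integers treated when the program is about to try the prime [q] for the
    cofactor [m]. *)
Definition visited (m q k : nat) : bool :=
  (0 < k <= n) && ((k %/ max_pdiv k < m) || ((k %/ max_pdiv k == m) && (max_pdiv k < q))).

(** Both the stored value and the recorded call, since each answer has to come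
    from Algorithm A or B. *)
Definition delta_table (P : pred nat) (s : state) : Prop :=
  forall k, P k -> ram s (6 * n.+1 + k) = delta k /\ (k, delta k) \in log s.

(** Algorithm B requires primes that do not divide [m]; among the primes tried, all
    at least [max_pdiv m], these are the ones that exceed [max_pdiv m]. *)
Definition vector_ready (m q : nat) (s : state) : Prop :=
  reg s rB = 0 \/
  [/\ prime (reg s rB), max_pdiv m < reg s rB < q, m * reg s rB <= n,
      reg s rW = delta (m * reg s rB) &
      forall t, t < m * reg s rB -> ram s t = delta_bit (m * reg s rB) t].

(** A bound for the time spent in calls for the cofactor [m]: Algorithm A is called
    at [q = max_pdiv m] and once more to start the chain, and the calls of
    Algorithm B telescope in the last prime [b]. *)
Definition potential (m q b : nat) : nat :=
  700 * nlog n * ((max_pdiv m < q) + (b != 0)) + 1500 * (quot_sum m * b).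

Lemma visited_skip m q : max_pdiv q != q -> visited m q.+1 =1 visited m q.
Proof.
move=> hq k; rewrite /visited [max_pdiv k < q.+1]ltnS [max_pdiv k <= q]leq_eqVlt.
case: (eqVneq (max_pdiv k) q) => //= e.
by rewrite -e max_pdiv_idem e eqxx in hq.
Qed.

Lemma visited_step m q k : visited m q.+1 k -> k != m * q -> visited m q k.
Proof.
rewrite /visited => /andP [-> /orP [->//|/andP [e le]]] ne; move: le.
rewrite ltnS leq_eqVlt => /orP [/eqP eq|->]; last by rewrite e orbT.
case/eqP: ne; rewrite -eq -(eqP e) divnK //; exact: max_pdiv_dvd.
Qed.

Lemma visited_start m : visited m (max_pdiv m) =1 visited m 0.
Proof.
move=> k; rewrite /visited; case: (boolP (0 < k <= n)) => //= /andP [k0 _]; congr (_ || _).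
case: eqP => //= <-; apply/negbTE; rewrite -leqNgt; exact: max_pdiv_cofactor.
Qed.

Lemma visited_end m q k : n %/ m < q -> visited m.+1 0 k -> visited m q k.
Proof.
move=> hq; rewrite /visited => /andP [/andP [k0 kn]]; rewrite k0 kn /= ltnS andbF orbF.
rewrite leq_eqVlt => /orP [/eqP e|->//]; rewrite e eqxx; apply/orP; right.
apply: leq_ltn_trans hq; rewrite leq_divRL; last by rewrite -e divn_gt0 ?max_pdiv_leq.
by rewrite -e mulnC divnK ?max_pdiv_dvd.
Qed.

(** The cost of a call is paid by the increase of the potential. *)
Lemma visit_wp s m q : layout n s -> 0 < m -> m * q <= n -> 0 < q -> max_pdiv m <= q ->
  max_pdiv q = q -> reg s rM = m -> reg s rU = q -> reg s rF = max_pdiv m ->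
  prime_table s -> delta_table (visited m q) s -> vector_ready m q s ->
  wp w visit s (fun s' t => [/\ prime_table s', delta_table (visited m q.+1) s', vector_ready m q.+1 s' &
    t + potential m q (reg s rB) <= 50 + potential m q.+1 (reg s' rB)]).
Proof.
move=> lay m0 mqn q0 gq eq hM hU hF hG hD hv; have lW := word_linear hW.
have W0 : 0 < W by lia. have W1 : 1 < W by lia. have W2 : 2 < W by lia.
case: (lay) => [l1 l2 l3 [l4 l5 l6 l7]].
have k0 : 0 < m * q by rewrite muln_gt0 m0.
have MUW : reg s rM * reg s rU < W by rewrite hM hU; clear -mqn lW; lia.
rewrite /visit; wsteps.
rewrite hM hU.
set s1 := set_reg s rLEN (m * q).
have lay1 : layout n s1 by split=> //; split.
apply: (wp_mono (Q := fun s2 t2 => [/\ reg s2 rW = delta (m * q),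
    forall t, t < m * q -> ram s2 t = delta_bit (m * q) t,
    forall x, 5 * n.+1 <= x -> ram s2 x = ram s x,
    log s2 = rcons (log s) (m * q, delta (m * q)) &
    t2 <= 20 + if reg s rB == 0 then 700 * nlog n else 1500 * ((q - reg s rB) * quot_sum m)])).
  2: { apply: (wp_if EW); [side | |] => /=; rewrite /upd /= => hb.
    - have hb0 : reg s rB = 0 by case: (eqVneq (reg s rB) 0) hb.
      rewrite hb0 eqxx; apply: wp_mono (callA_wp EW hW lay1 (k := m * q) _ _); rewrite ?k0 //.
      move=> s2 t2 fr2 [h1 h2 h3 h4 h5]; split=> //.
      + move=> x hx; rewrite h3 //; apply: leq_trans hx; rewrite leq_mul2r; lia.
      + have := quot_sum_le_nlog mqn; clear -h5; lia.
    - have hb0 : reg s rB != 0 by case: (eqVneq (reg s rB) 0) hb.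
      rewrite (negbTE hb0); case: hv => [e|]; first by rewrite e in hb0.
      case=> pb /andP [gb bq] mbn hWb hvb.
      have q1 : 1 < q by apply: leq_trans bq; rewrite ltnS prime_gt0.
      have pq : prime q by apply: max_pdiv_id_prime.
      have nb : ~~ (reg s rB %| m) by apply/negP => h; have := max_pdiv_ge m0 pb h; rewrite leqNgt gb.
      have nq : ~~ (q %| m).
        by apply/negP => h; have := max_pdiv_ge m0 pq h; rewrite leqNgt (ltn_trans gb bq).
      apply: wp_mono (callB_wp EW hW lay1 m0 mqn pb pq bq nb nq _ _ _ _ _) => //.
      move=> s2 t2 fr2 [h1 h2 h3 h4 h5]; split=> //.
      by clear -h5; lia. }
move=> s2 t2 fr2 [h1 h2 h3 h4 h5]; wreg fr2 rD; wreg fr2 rLEN; wreg fr2 rU; wreg fr2 rF; wreg fr2 rB; wreg fr2 rM.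
have DW : reg s2 rD + reg s2 rLEN < W by rewrite erD erLEN l7; clear -mqn lW; lia.
wsteps; rewrite erD erLEN l7 h1.
apply: (wp_mono (Q := fun s3 t3 => [/\ ram s3 = upd (ram s2) (6 * n.+1 + m * q) (delta (m * q)), log s3 = log s2,
    reg s3 rB = (if q == max_pdiv m then 0 else q), reg s3 rW = delta (m * q) & t3 <= 10])).
  2: { apply: (wp_if EW); [by side | |] => /=; rewrite erU erF hU hF => hc.
    - have -> : (q == max_pdiv m) by case: (q == _) hc.
      by wsteps.
    - have -> : (q == max_pdiv m) = false by case: (q == _) hc.
      by wsteps; rewrite erU hU. }
move=> s3 t3 fr3 [hram hlog hB3 hW3 ht3].
wsteps; split.
- move=> k hk; rewrite hram /upd ifF; last by apply/negbTE/eqP; case/andP: hk; clear; lia.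
  by rewrite h3 ?hG //; clear; lia.
- move=> k hk; rewrite hram hlog h4 /upd eqn_add2l mem_rcons inE.
  case: (eqVneq k (m * q)) => [->|ne]; first by rewrite eqxx.
  have [e1 e2] := hD k (visited_step hk ne).
  by rewrite h3 ?e1 ?e2 ?orbT //; clear; lia.
- rewrite /vector_ready hB3; case: (eqVneq q (max_pdiv m)) => e; [by left | right].
  have gq' : max_pdiv m < q by rewrite ltn_neqAle eq_sym e.
  split=> //.
  + apply: max_pdiv_id_prime => //; exact: leq_ltn_trans (max_pdiv_gt0 m) gq'.
  + by rewrite gq' ltnSn.
  + move=> t ht; rewrite hram /upd ifF ?h2 //; apply/negbTE/eqP; clear -ht mqn; lia.
rewrite hB3 /potential ltnS gq; clear -h5 ht3 hv q0 gq eq.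
move: (nlog n) (quot_sum m) h5 => H K.
case: hv => [e|[pb /andP [gb bq] _ _ _]].
  rewrite e eqxx muln0; case: (eqVneq q (max_pdiv m)) => e'.
    by rewrite -e' ltnn; clear -ht3; lia.
  have -> : max_pdiv m < q by rewrite ltn_neqAle eq_sym e' gq.
  have -> : q != 0 by rewrite -lt0n.
  clear -ht3; lia.
have b0 := prime_gt0 pb.
have -> : (q == max_pdiv m) = false by rewrite gtn_eqF // (ltn_trans gb).
rewrite (gtn_eqF b0) (gtn_eqF q0) (ltn_trans gb bq).
have : K * q = K * reg s rB + (q - reg s rB) * K.
  by rewrite [_ * K]mulnC -mulnDr subnKC // ltnW.
clear -ht3; move: (K * q) (K * _) (_ * K) => A B C; lia.
Qed.

(** For [m * max_pdiv m > n] the loop body is never entered.  Otherwise the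
    potential ends below [3000 * nlog n]: the last prime [b] satisfies [m * b <= n]
    and [quot_sum m <= m log m]. *)
Lemma chain_wp s m : layout n s -> 0 < m <= n -> reg s rM = m ->
  prime_table s -> delta_table (visited m 0) s ->
  wp w chain s (fun s' t => [/\ prime_table s', delta_table (visited m.+1 0) s' &
    t <= 50 + (m * max_pdiv m <= n) * (4000 * nlog n)]).
Proof.
move=> lay /andP [m0 mn] hM hG hD; have lW := word_linear hW.
have W0 : 0 < W by lia. have W1 : 1 < W by lia. have W2 : 2 < W by lia.
case: (lay) => [l1 l2 l3 [l4 l5 l6 l7]].
have hg : ram s (5 * n.+1 + m) = max_pdiv m by rewrite hG // m0.
have GW : reg s rG + reg s rM < W by rewrite l6 hM; clear -mn lW; lia.
have NM : n %/ m <= n := leq_div n m.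
have NW : n < W by clear -lW; lia.
have LW : n %/ m + 1 < W by move: NM; move: (n %/ m) => d NM; clear -NM lW; lia.
have INW : reg s rIN < W by rewrite l1.
have DW : reg s rIN %/ reg s rM + 1 < W by rewrite l1 hM.
rewrite /chain; wsteps; rewrite l6 hM hg l1.
set g := max_pdiv m.
(* the loop is not entered if g > n / m, hence the maximum *)
apply: (wp_for EW (a:=g) (b:=maxn g (n %/ m).+1) (I := fun q s1 t => [/\ reg s1 rU = q,
   prime_table s1, delta_table (visited m q) s1, vector_ready m q s1 & t <= 80 * (q - g) + potential m q (reg s1 rB)])) => //=.
- exact: leq_maxl.
- split=> //; last by left.
  by move=> k hk; apply: hD; rewrite -visited_start.
- move=> q s1 t /andP [gq hq] fr [hU hG1 hD1 hv ht].
  have qm : q <= n %/ m by move: hq; rewrite leq_max ltnNge gq.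
  have mqn : m * q <= n by rewrite mulnC -leq_divRL.
  have lay1 : layout n s1 by apply: (frame_layout fr isT).
  case: (lay1) => [a1 a2 a3 [a4 a5 a6 a7]].
  have q0 : 0 < q by apply: leq_trans gq; exact: max_pdiv_gt0.
  have qn : q <= n := leq_trans qm NM.
  wreg fr rM; wreg fr rF; wreg fr rLim.
  have GU : reg s1 rG + reg s1 rU < W by rewrite a6 hU; clear -qn lW; lia.
  split; [by side | by rewrite hU erLim addn1 ltnS qm | ].
  wsteps.
  apply: (wp_mono (Q := fun s2 t2 => [/\ prime_table s2, delta_table (visited m q.+1) s2, vector_ready m q.+1 s2 &
    t2 + potential m q (reg s1 rB) <= 60 + potential m q.+1 (reg s2 rB)])).
    2: { apply: (wp_if EW); [by side | |] => /=; rewrite a6 hU hG1 ?q0 ?qn // => hc.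
      - have eq : max_pdiv q = q by case: (eqVneq (max_pdiv q) q) hc.
        apply: wp_mono (visit_wp lay1 m0 mqn q0 gq eq _ hU _ hG1 hD1 hv); rewrite ?erM ?erF //.
        move=> s2 t2 fr2 [b1 b2 b3 b4]; split=> //; clear -b4; lia.
      - have ne : max_pdiv q != q by case: (eqVneq (max_pdiv q) q) hc.
        wsteps; split=> //.
        + by move=> k; rewrite visited_skip //; exact: hD1.
        + case: hv => [|[v1 /andP [v2 v3] v4 v5 v6]]; [by left | right].
          by split=> //; rewrite v2 ltnS ltnW.
        + rewrite /potential ltnS; have hb : (max_pdiv m < q) <= (max_pdiv m <= q).
            by case: ltnP => // /ltnW ->.
          have := leq_mul (leqnn (700 * nlog n)) (leq_add hb (leqnn (reg s1 rB != 0 : nat))).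
          by move: (700 * _ * _) (700 * _ * _) => A B; clear; lia. }
  move=> s2 t2 fr2 [hG2 hD2 hv2 ht2]; wreg fr2 rU.
  have UW : reg s2 rU + 1 < W by rewrite erU hU; clear -qn lW; lia.
  wsteps; split=> //; first by rewrite erU hU addn1.
  by rewrite /upd /=; clear -ht ht2 gq; lia.
move=> s1 t fr [hU hG1 hD1 hv ht]; wreg fr rLim.
split; [by side | | ].
  by rewrite hU erLim addn1 ltnNge leq_maxr.
wsteps; split=> //.
- move=> k hk; apply: hD1; apply: visited_end hk; exact: leq_maxr.
have -> : (m * max_pdiv m <= n) = (g <= n %/ m) by rewrite leq_divRL // mulnC.
case: (leqP g (n %/ m)) => hgm; last first.
  rewrite (maxn_idPl hgm) in ht hv; have hb : reg s1 rB = 0.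
    by case: hv => // -[_ /andP [h1 h2]]; move: (ltn_trans h1 h2); rewrite ltnn.
  by move: ht; rewrite hb /potential ltnn subnn !muln0; clear; lia.
rewrite (maxn_idPr (leqW hgm)) in ht hv.
have hb : quot_sum m * reg s1 rB <= nlog n.
  case: hv => [->|[_ _ mb _ _]]; first by rewrite muln0.
  apply: leq_trans (leq_mul (quot_sum_log m) (leqnn _)) _; rewrite mulnAC /nlog.
  by apply: leq_mul => //; rewrite ltnS leq_trunc_log.
move: ht; rewrite /potential => ht.
have h1 : (max_pdiv m < (n %/ m).+1) + (reg s1 rB != 0) <= 2 by case: (_ < _); case: (_ != _).
have h2 : 80 * ((n %/ m).+1 - g) <= 80 * nlog n.
  rewrite leq_mul2l /=; apply: leq_trans (nlog_ge n); apply: leq_trans NM.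
  rewrite leq_subLR -addn1 addnC leq_add2r; exact: max_pdiv_gt0.
have h3 := leq_mul (leqnn (700 * nlog n)) h1.
have hn := nlog_ge n.
move: ht h2 h3 hb; rewrite mul1n; move: (80 * _) (700 * _ * (_ + _)) (quot_sum m * _) => A B C.
clear -n0 hn; move: (nlog n) hn => H; lia.
Qed.

Lemma chains_wp s : layout n s -> prime_table s ->
  wp w chains s (fun s' t => delta_table (fun k => 0 < k <= n) s' /\
    t <= 10 + 70 * n + \sum_(1 <= m < n.+1) (m * max_pdiv m <= n) * (4000 * nlog n)).
Proof.
move=> lay hG; have lW := word_linear hW.
have W0 : 0 < W by lia. have W1 : 1 < W by lia. have W2 : 2 < W by lia.
rewrite /chains; wsteps.
apply: (wp_for EW (a:=1) (b:=n.+1) (I := fun m s1 t => [/\ reg s1 rM = m,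
   prime_table s1, delta_table (visited m 0) s1 &
   t <= 70 * (m - 1) + \sum_(1 <= i < m) (i * max_pdiv i <= n) * (4000 * nlog n)])) => //=.
- split=> // k; rewrite /visited andbF orbF => /andP [/andP [k0 kn]].
  by rewrite ltnS leqn0 -leqn0 leqNgt divn_gt0 ?max_pdiv_leq.
- move=> m s1 t /andP [m1 mn] fr [hM hG1 hD1 ht].
  have lay1 : layout n s1 by apply: (frame_layout fr isT); split; case: lay => // ? ? ? [].
  case: (lay1) => [a1 a2 a3 [a4 a5 a6 a7]].
  split; [by side | by rewrite hM a2 mn | ].
  wsteps.
  apply: wp_mono (chain_wp lay1 _ hM hG1 hD1); last by rewrite m1 -ltnS mn.
  move=> s2 t2 fr2 [hG2 hD2 ht2]; wreg fr2 rM.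
  have MW : reg s2 rM + 1 < W by rewrite erM hM; clear -mn lW; lia.
  wsteps; split=> //; first by rewrite erM hM addn1.
  rewrite big_nat_recr //=; move: ht ht2; move: (\sum_(1 <= _ < _) _) (_ * (4000 * _)) => A B.
  by clear -m1; lia.
move=> s1 t fr [hM hG1 hD1 ht]; wreg fr rS.
have e2 : reg s rS = n.+1 by case: lay.
split; [by side | by rewrite hM erS e2 ltnn | ].
wsteps; split; last by move: ht; move: (\sum_(1 <= _ < _) _) => A; clear; lia.
move=> k /andP [k0 kn]; apply: hD1; rewrite /visited k0 kn /= ltnS.
by rewrite (leq_trans (leq_div _ _) kn).
Qed.

End Main.

(** * The program *)

Definition setup : cmd := seqs [::
  Assign rS (Op Add (Reg rIN) (Cst 1));
  Assign rP (Reg rS);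
  Assign rQ (Op Mul (Cst 3) (Reg rS));
  Assign rG (Op Mul (Cst 5) (Reg rS));
  Assign rD (Op Mul (Cst 6) (Reg rS))].

Definition output_table : cmd := seqs [::
  Assign rM (Cst 1);
  Assign rX (Cst 0);
  While (Op Lt (Reg rM) (Reg rS)) (seqs [::
    Assign rX (Op Add (Reg rX) (Op Sub (Reg rM) (Mem (Op Add (Reg rD) (Reg rM)))));
    Output (Reg rX);
    incr rM])].

Definition tabulate : cmd := seqs [:: setup; sieve; chains; output_table].

Lemma M0 : M 0 = 0. Proof. by []. Qed.

Lemma M_le_sq k : M k <= k * k.
Proof.
elim: k => [|k IH]; first by rewrite M0.
rewrite M_rec //=; have := leq_subr (delta k.+1) k.+1; nia.
Qed.

Definition num_chains (n : nat) : nat := \sum_(1 <= m < n.+1) (m * max_pdiv m <= n).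

Section Main.
Variables (w W n : nat).
Hypothesis EW : word_bound w W.
Hypothesis hW : 256 * (n.+1 * n.+1) <= W.
Hypothesis n0 : 0 < n.

Lemma output_wp s : layout n s -> delta_table n (fun k => 0 < k <= n) s -> out s = [::] ->
  wp w output_table s (fun s' t => [/\ out s' = [seq M k | k <- iota 1 n],
    log s' = log s & t <= 10 + 30 * n]).
Proof.
move=> lay hD ho; have lW := word_linear hW.
have W0 : 0 < W by lia. have W1 : 1 < W by lia. have W2 : 2 < W by lia.
rewrite /output_table; wsteps.
apply: (wp_for EW (a:=0) (b:=n) (I := fun i s1 t => [/\ reg s1 rM = i.+1,
   reg s1 rX = M i, ram s1 = ram s, out s1 = [seq M k | k <- iota 1 i] & t <= 30 * i])) => //=.
- move=> i s1 t hi fr [hM hX hram hout ht].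
  have lay1 : layout n s1 by apply: (frame_layout fr isT); split; case: lay => // ? ? ? [].
  case: (lay1) => [a1 a2 a3 [a4 a5 a6 a7]].
  have [hd _] := hD i.+1 hi.
  have MW : reg s1 rM < W by rewrite hM; clear -hi lW; lia.
  have MW1 : reg s1 rM + 1 < W by rewrite hM; clear -hi lW; lia.
  have DW : reg s1 rD + reg s1 rM < W by rewrite a7 hM; clear -hi lW; lia.
  have hd1 : ram s1 (reg s1 rD + reg s1 rM) = delta i.+1 by rewrite hram a7 hM.
  have eM : reg s1 rX + (reg s1 rM - ram s1 (reg s1 rD + reg s1 rM)) = M i.+1.
    by rewrite hd1 hX hM [in RHS]M_rec.
  have XW : reg s1 rX + (reg s1 rM - ram s1 (reg s1 rD + reg s1 rM)) < W.
    rewrite eM; apply: leq_ltn_trans (M_le_sq _) _.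
    have : i.+1 * i.+1 <= n.+1 * n.+1 by apply: leq_mul; exact: leqW.
    by clear -hW; move: hW; move: (n.+1 * n.+1) (i.+1 * i.+1) => A B; lia.
  split; [by side | by rewrite hM a2 ltnS hi | ].
  wsteps; split=> //.
  + by rewrite hM addn1.
  + have e : iota 1 i.+1 = rcons (iota 1 i) i.+1.
      by rewrite -cats1 -[i.+1 in LHS]addn1 iotaD add1n.
    by rewrite hout eM -map_rcons -e.
  + by move: ht; clear; lia.
move=> s1 t fr [hM hX hram hout ht]; wreg fr rS.
have e2 : reg s rS = n.+1 by case: lay.
split; [by side | by rewrite hM erS e2 ltnn | ].
wsteps; split=> //; last by move: ht; clear; lia.
by case: fr => _ _ -> //=.
Qed.

Lemma tabulate_wp :
  wp w tabulate (init n) (fun s' t => [/\ out s' = [seq M k | k <- iota 1 n],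
    forall k, 1 <= k <= n -> (k, delta k) \in log s' & t <= 5000 * (nlog n * num_chains n)]).
Proof.
have lW := word_linear hW.
have W0 : 0 < W by lia. have W1 : 1 < W by lia. have W2 : 2 < W by lia.
rewrite /tabulate; wstep; wstep.
apply: (wp_mono (Q := fun s t => [/\ layout n s, ram s = (fun=> 0), out s = [::] & t <= 50])).
  2: { rewrite /setup; wsteps; split=> //; rewrite /layout /= /upd /= ?addn1 //. }
move=> s1 t1 fr1 [lay1 hram1 ho1 ht1]; wstep.
apply: (wp_mono _ (sieve_wp EW hW n0 lay1 _)); last by move=> k _; rewrite hram1.
move=> s2 t2 fr2 [hG2 ht2]; wstep.
have lay2 : layout n s2 by apply: (frame_layout fr2 isT).
apply: (wp_mono _ (chains_wp EW hW n0 lay2 hG2)).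
move=> s3 t3 fr3 [hD3 ht3]; wstep.
have lay3 : layout n s3 by apply: (frame_layout fr3 isT).
have ho3 : out s3 = [::].
  by case: fr3 => _ -> // _; case: fr2 => _ -> // _.
apply: (wp_mono _ (output_wp lay3 hD3 ho3)).
move=> s4 t4 fr4 [ho4 hl4 ht4]; wsteps; split=> //.
  by move=> k hk; rewrite hl4; case: (hD3 k hk).
have hN : 0 < num_chains n by rewrite /num_chains big_ltn // mul1n max_pdiv1 n0.
have hn : n <= nlog n := nlog_ge n.
have hH : nlog n <= nlog n * num_chains n by rewrite leq_pmulr.
have e : \sum_(1 <= m < n.+1) (m * max_pdiv m <= n) * (4000 * nlog n) = 4000 * (nlog n * num_chains n).
  by rewrite -big_distrl /= mulnC -mulnA.
move: ht3; rewrite e; move: ht1 ht2 ht4 hn hH n0; clear.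
move: (nlog n) (_ * num_chains n) => A B; lia.
Qed.

End Main.

(** The word size is ten times the binary length of [n], so that words hold
    [256 * (n + 1) ^ 2], more than any address or intermediate value. *)
Theorem tabulates_tabulate : exists C, forall n, 0 < n ->
  exists2 t, tabulates 10 tabulate n t & t <= C * (nlog n * num_chains n).
Proof.
(* 4000 for the chains, the rest for the sieve and the linear phases *)
exists 5000 => n n0.
have hW : 256 * (n.+1 * n.+1) <= 2 ^ word_size 10 n.
  rewrite /word_size [10 * _]mulnC expnM; set Z := 2 ^ _.
  have hZ : n.+1 <= Z by apply: trunc_log_ltn.
  have Z2 : 2 <= Z by rewrite /Z expnS leq_pmulr // expn_gt0.
  rewrite (expnD Z 8 2); apply: leq_mul; last by rewrite expnS expn1 leq_mul.
  by rewrite (_ : 256 = 2 ^ 8) // leq_exp2r.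
have [s [t [ex [h1 h2 h3]]]] := tabulate_wp (erefl : word_bound _ _) hW n0.
by exists t => //; exists s.
Qed.

(** * Counting smooth numbers *)

Definition smooth_count (x y : nat) : nat := count (fun m => max_pdiv m <= y) (iota 1 x).

(** Buchstab's recursion: dividing by [p] the integers whose largest prime factor
    is [p] leaves [p]-smooth ones. *)
Lemma smooth_count_prime x p : prime p -> smooth_count x p <= smooth_count x p.-1 + smooth_count (x %/ p) p.
Proof.
move=> pp; have p0 := prime_gt0 pp; rewrite /smooth_count.
set B := [pred m | max_pdiv m == p].
apply: (@leq_trans (count (fun m => max_pdiv m <= p.-1) (iota 1 x) + count B (iota 1 x))).
  rewrite -count_predUI; apply: (leq_trans _ (leq_addr _ _)).
  by apply: sub_count => m /=; clear -p0; lia.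
rewrite leq_add2l -!size_filter.
set s := [seq m <- iota 1 (x %/ p) | max_pdiv m <= p].
rewrite -(size_map (fun m => m * p) s); apply: uniq_leq_size; first by rewrite filter_uniq ?iota_uniq.
move=> m; rewrite mem_filter mem_iota /= => /andP [/eqP hm /andP [m0 mx]].
have pm : p %| m by rewrite -hm max_pdiv_dvd.
apply/mapP; exists (m %/ p); last by rewrite divnK.
have d0 : 0 < m %/ p by rewrite divn_gt0 // dvdn_leq.
rewrite mem_filter mem_iota d0 add1n ltnS leq_div2r ?andbT; last by rewrite add1n ltnS in mx.
by rewrite -{2}hm -{1}hm max_pdiv_cofactor.
Qed.

Lemma smooth_count_nprime x p : 1 < p -> ~~ prime p -> smooth_count x p <= smooth_count x p.-1.
Proof.
move=> p1 np; apply: sub_count => m /=; rewrite leq_eqVlt => /orP [/eqP e|]; last by clear -p1; lia.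
case: (ltnP 1 m) => m1; first by rewrite -e max_pdiv_prime in np.
by case: m m1 e => [|[|]] // _ e; rewrite -e in p1.
Qed.

Lemma smooth_count1 x : smooth_count x 1 <= 1.
Proof.
case: x => [|x] //; rewrite /smooth_count /= (_ : count _ _ = 0) //.
apply/eqP; rewrite -leqn0 leqNgt -has_count; apply/hasPn => m; rewrite mem_iota => /andP [m1 _].
by rewrite -ltnNge prime_gt1 // max_pdiv_prime.
Qed.

(** If [m > n / Y] and [m * max_pdiv m <= n] then [max_pdiv m < Y]. *)
Lemma num_chains_le n Y : 0 < Y -> num_chains n <= n %/ Y + smooth_count n Y.
Proof.
move=> Y0; rewrite /num_chains /smooth_count.
have -> : \sum_(1 <= m < n.+1) (m * max_pdiv m <= n) = count (fun m => m * max_pdiv m <= n) (iota 1 n).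
  by rewrite /index_iota subn1 -sum1_count [RHS]big_mkcond /=; apply: eq_bigr => m _; case: ifP.
apply: (@leq_trans (count (fun m => m <= n %/ Y) (iota 1 n) + count (fun m => max_pdiv m <= Y) (iota 1 n))).
  rewrite -count_predUI; apply: (leq_trans _ (leq_addr _ _)).
  apply: sub_count => m /= hm; case: (leqP m (n %/ Y)) => //= h; rewrite leqNgt; apply/negP => h'.
  have := ltn_divLR n m Y0; rewrite h => /esym; rewrite ltnNge => /negP; apply.
  by apply: leq_trans hm; rewrite leq_mul2l ltnW ?orbT.
rewrite leq_add2r -size_filter -[leqRHS](size_iota 1); apply: uniq_leq_size.
  by rewrite filter_uniq ?iota_uniq.
by move=> m; rewrite mem_filter !mem_iota !add1n !ltnS => /and3P [-> -> _].
Qed.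

(** * Primes between consecutive powers of two *)

Lemma prime_dvd_fact p n : prime p -> p %| n`! -> p <= n.
Proof.
move=> pp; elim: n => [|n IH]; first by rewrite fact0 dvdn1 => /eqP e; rewrite e in pp.
rewrite factS Euclid_dvdM // => /orP [h|/IH h]; last exact: leqW.
exact: dvdn_leq.
Qed.

Lemma central_bin_le N : 'C(2 * N, N) <= 2 ^ (2 * N).
Proof.
have := expnDn 1 1 (2 * N); rewrite addn1 => ->.
have hN : N < (2 * N).+1 by lia.
rewrite (bigD1 (Ordinal hN)) //= !exp1n !muln1; exact: leq_addr.
Qed.

Lemma prod_primes_dvd (s : seq nat) d : uniq s -> (forall p, p \in s -> prime p && (p %| d)) ->
  \prod_(p <- s) p %| d.
Proof.
elim: s => [|p s IH] /=; first by rewrite big_nil dvd1n.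
move=> /andP [ps us] h; rewrite big_cons Gauss_dvd.
  have /andP [_ ->] := h p (mem_head _ _); rewrite IH // => r hr.
  by apply: h; rewrite in_cons hr orbT.
have /andP [pp _] := h p (mem_head _ _).
have hs r : r \in s -> prime r by move=> hr; have /andP [] := h r (mem_behead (s := p :: s) hr).
elim: s ps hs {IH us h} => [|r s IH]; first by rewrite big_nil coprimen1.
rewrite in_cons negb_or => /andP [pr ps] hs; rewrite big_cons coprimeMr IH //.
  by rewrite andbT prime_coprime // dvdn_prime2 // hs // mem_head.
by move=> r' hr'; apply: hs; rewrite in_cons hr' orbT.
Qed.

(** The primes p with N < p <= 2 N all divide the central binomial coefficient, which is
    at most 4 ^ N; here N = 2 ^ k, so that each of them exceeds 2 ^ k. *)
Lemma count_primes_dyadic k :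
  k * count prime (iota (2 ^ k).+1 (2 ^ k)) <= 2 ^ k.+1.
Proof.
set N := 2 ^ k; set s := [seq p <- iota N.+1 N | prime p].
have N0 : 0 < N by rewrite expn_gt0.
have hs p : p \in s -> [/\ prime p, N < p & p <= 2 * N].
  by rewrite mem_filter mem_iota => /and3P [-> -> h]; split=> //; move: h; clear; lia.
have hdvd : \prod_(p <- s) p %| 'C(2 * N, N).
  apply: prod_primes_dvd; first by rewrite filter_uniq ?iota_uniq.
  move=> p /hs [pp Np p2N]; rewrite pp /=.
  have hb : 'C(2 * N, N) * (N`! * (2 * N - N)`!) = (2 * N)`! by apply: bin_fact; lia.
  have : p %| (2 * N)`! by rewrite dvdn_fact // prime_gt0.
  rewrite -hb (_ : 2 * N - N = N); last by clear; lia.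
  rewrite !Euclid_dvdM // => /orP [//|/orP []] /(prime_dvd_fact pp); by rewrite leqNgt Np.
have hC : 0 < 'C(2 * N, N) by rewrite bin_gt0; lia.
have h1 : \prod_(p <- s) p <= 2 ^ (2 * N) := leq_trans (dvdn_leq hC hdvd) (central_bin_le N).
have h2 : 2 ^ (k * size s) <= \prod_(p <- s) p.
  rewrite expnM -/N; elim: s hs {hdvd h1} => [|p s IH] hs; first by rewrite big_nil.
  rewrite /= expnS big_cons leq_mul //.
    by have [_ /ltnW] := hs p (mem_head _ _).
  by apply: IH => r hr; apply: hs; rewrite in_cons hr orbT.
have := leq_trans h2 h1; rewrite leq_exp2l // size_filter => h3.
by rewrite expnS.
Qed.

Import Order.TTheory GRing.Theory Num.Theory.
Import numFieldNormedType.Exports.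
Local Open Scope classical_set_scope.
Local Open Scope ring_scope.

Section Analytic.
Variable R : realType.
Implicit Types (s f : R).

(** * Analytic bounds *)

Lemma iotaS_rcons m n : iota m n.+1 = rcons (iota m n) (m + n)%N.
Proof. by rewrite -cats1 -addn1 iotaD. Qed.

(** This bounds an Euler factor by an exponential; 3/4 is admissible for
    [f = p ^ (- s)] because [2 ^ (- 1 / 2) <= 3 / 4]. *)
Lemma expRN4_le f : 0 <= f <= 3 / 4 -> expR (- (4 * f)) <= 1 - f.
Proof.
move=> /andP [f0 f1]; rewrite expRN.
have h : 1 + 4 * f <= expR (4 * f) by exact: expR_ge1Dx.
have p : 0 < 1 + 4 * f by lra.
apply: (@le_trans _ _ (1 + 4 * f)^-1); first by rewrite lef_pV2 ?posrE // expR_gt0.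
rewrite -[leLHS]mul1r ler_pdivrMr //; nra.
Qed.

(** The power [n ^ s] of a positive integer; written with the exponential so that
    products of powers become sums of exponents. *)
Definition expr_nat (s : R) (n : nat) : R := expR (s * ln n%:R).

Lemma expr_nat_gt0 s n : 0 < expr_nat s n. Proof. exact: expR_gt0. Qed.

Lemma ln_nat_ge0 n : 0 <= ln n%:R :> R.
Proof. by case: n => [|n]; [rewrite ln0 | rewrite ln_ge0 // ler1n]. Qed.

Lemma expr_nat_prime_le s p : 1 / 2 <= s -> prime p -> expr_nat (- s) p <= 3 / 4.
Proof.
move=> s2 pp; rewrite /expr_nat.
have p2 : (2 : R) <= p%:R by rewrite ler_nat prime_gt1.
have hl : ln (2 : R) <= ln p%:R by rewrite ler_ln ?posrE //; lra.
have l2 : 0 <= ln (2 : R) by rewrite ln_ge0 //; lra.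
have h : expR (- s * ln p%:R) ^+ 2 <= 1 / 2.
  rewrite -expRM_natl; apply: (@le_trans _ _ (expR (- ln 2))).
    by rewrite ler_expR; nra.
  by rewrite expRN lnK ?posrE //; lra.
have := expR_gt0 (- s * ln p%:R); move: (expR _) h => a; nra.
Qed.

(** The number of smooth integers satisfies the recursion of [smooth_count_prime],
    of which [x ^ s] times the Euler product over [p <= y] is a supersolution:
    [x ^ s E(p - 1) + (x / p) ^ s E(p) = x ^ s E(p)].  The factor
    [(1 - p ^ (- s)) ^ -1] is replaced by its bound [exp (4 p ^ (- s))]. *)
Lemma rankin s y x : 1 / 2 <= s -> (0 < y)%N -> (0 < x)%N ->
  (smooth_count x y)%:R <= expr_nat s x * expR (4 * \sum_(p <- iota 1 y | prime p) expr_nat (- s) p).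
Proof.
move=> s2; elim: y x => // y IHy x _.
case: (posnP y) => [->|y0] x0.
  apply: (@le_trans _ _ 1); first by rewrite (ler_nat _ _ 1) smooth_count1.
  rewrite big_cons big_nil /= mulr0 expR0 mulr1 /expr_nat -[leLHS]expR0 ler_expR mulr_ge0 ?ln_nat_ge0 //; lra.
rewrite iotaS_rcons add1n big_rcons /=; case: ifP => py; last first.
  rewrite addr0 (le_trans _ (IHy _ y0 x0)) // ler_nat.
  by apply: smooth_count_nprime; rewrite ?py.
set p := y.+1; set S := \sum_(_ <- _ | _) _; set f := expr_nat (- s) p.
have f0 : 0 < f by exact: expr_nat_gt0.
have f34 : f <= 3 / 4 by exact: expr_nat_prime_le.
have hf : expR (- (4 * f)) <= 1 - f by apply: expRN4_le; rewrite ltW.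
have e4 : expR (4 * (S + f)) = expR (4 * f) * expR (4 * S) by rewrite mulrDr expRD mulrC.
rewrite e4; elim/ltn_ind: x x0 => x IHx x0.
have h1 := IHy x y0 x0.
have h2 : (smooth_count (x %/ p) p)%:R <= expr_nat s x * f * (expR (4 * f) * expR (4 * S)).
  case: (posnP (x %/ p)) => [->|d0].
    by rewrite /smooth_count /= !mulr_ge0 ?expR_ge0 // ltW ?expr_nat_gt0.
  apply: le_trans (IHx _ _ d0) _; first by rewrite ltn_Pdiv.
  rewrite ler_wpM2r ?mulr_ge0 ?expR_ge0 // /f /expr_nat -expRD ler_expR mulNr -mulrBr ler_wpM2l //; first lra.
  have p0 : 0 < p%:R :> R by rewrite ltr0n.
  rewrite -ln_div ?posrE ?ltr0n // ler_ln ?posrE ?ltr0n ?divr_gt0 ?ltr0n //.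
  by rewrite ler_pdivlMr // -natrM ler_nat leq_trunc_div.
have h3 : (smooth_count x p)%:R <= (smooth_count x y)%:R + (smooth_count (x %/ p) p)%:R :> R.
  by rewrite -natrD ler_nat; exact: smooth_count_prime.
apply: (le_trans h3); apply: (le_trans (lerD h1 h2)).
have E0 := expR_gt0 (4 * f).
have hE : 1 <= (1 - f) * expR (4 * f).
  by rewrite -ler_pdivrMr // div1r -expRN.
have P0 : 0 < expr_nat s x * expR (4 * S) by rewrite mulr_gt0 ?expR_gt0.
rewrite -subr_ge0; set Ef := expR (4 * f) in hE *; set ES := expR (4 * S) in P0 *.
have -> : expr_nat s x * (Ef * ES) - (expr_nat s x * ES + expr_nat s x * f * (Ef * ES)) =
  expr_nat s x * ES * ((1 - f) * Ef - 1) by ring.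
by apply: mulr_ge0; [exact: ltW | rewrite subr_ge0].
Qed.

Lemma dyadic_prime_sum k : (0 < k)%N ->
  \sum_(p <- iota (2 ^ k).+1 (2 ^ k) | prime p) (p%:R : R)^-1 <= 2 / k%:R.
Proof.
move=> k0; have N0 : 0 < (2 ^ k)%:R :> R by rewrite ltr0n expn_gt0.
apply: (@le_trans _ _ (\sum_(p <- iota (2 ^ k).+1 (2 ^ k) | prime p) ((2 ^ k)%:R : R)^-1)).
  rewrite big_seq_cond [leRHS]big_seq_cond; apply: ler_sum => p; rewrite mem_iota.
  move=> /andP [/andP [hp _] _].
  rewrite lef_pV2 ?ler_nat ?(ltnW hp) // posrE ltr0n; exact: leq_trans hp.
rewrite big_const_seq iter_addr_0 -[_^-1 *+ _]mulr_natl.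
rewrite ler_pdivrMr // mulrAC ler_pdivlMr ?ltr0n // -!natrM ler_nat mulnC -expnS.
exact: count_primes_dyadic.
Qed.

Lemma harmonic_le K : (0 < K)%N -> \sum_(1 <= k < K.+1) (k%:R : R)^-1 <= 1 + ln K%:R.
Proof.
elim: K => // K IH _; case: (posnP K) => [->|K0].
  by rewrite big_nat1 invr1 ln1 addr0.
rewrite big_nat_recr //=; have := IH K0.
have h0 : 0 < K%:R :> R by rewrite ltr0n.
have h1 : 0 < K.+1%:R :> R by rewrite ltr0n.
set c : R := K.+1%:R^-1.
have c1 : c < 1 by rewrite invf_lt1 // ltr1n ltnS.
have hK : K%:R = K.+1%:R * (1 + - c) :> R.
  by rewrite mulrDr mulr1 mulrN mulfV ?gt_eqF // -natr1 addrK.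
clearbody c.
have h3 : -1 < - c by lra.
have h4 : 0 < 1 + - c by lra.
have := le_ln1Dx h3; rewrite [in ln K%:R]hK lnM ?posrE //.
set S := \sum_(_ <= _ < _) _; move: (ln (1 + _)) (ln K.+1%:R) => a b; lra.
Qed.

(** The block between [2 ^ k] and [2 ^ k.+1] contributes at most [2 / k] by
    Chebyshev's bound, and the harmonic sum of these is logarithmic in [K]. *)
Lemma prime_sum_pow2 K : (0 < K)%N ->
  \sum_(p <- iota 1 (2 ^ K) | prime p) (p%:R : R)^-1 <= 3 + 2 * ln K%:R.
Proof.
move=> K0; apply: (@le_trans _ _ (2^-1 + 2 * \sum_(1 <= k < K) (k%:R : R)^-1)).
  elim: K K0 => // K IH _; case: (posnP K) => [->|K0].
    by rewrite big_geq // !big_cons big_nil /= mulr0 addr0.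
  rewrite expnS mul2n -addnn iotaD big_cat /= add1n big_nat_recr //= mulrDr addrA.
  by apply: lerD; [exact: IH | exact: dyadic_prime_sum].
have : \sum_(1 <= k < K) (k%:R : R)^-1 <= \sum_(1 <= k < K.+1) (k%:R : R)^-1.
  by rewrite [leRHS]big_nat_recr //= lerDl invr_ge0.
have := harmonic_le K0; set A := \sum_(_ <= _ < _) _; set B := \sum_(_ <= _ < _) _.
lra.
Qed.

Lemma prime_sum_le n : (0 < n)%N ->
  \sum_(p <- iota 1 n | prime p) (p%:R : R)^-1 <= 3 + 2 * ln (trunc_log 2 n).+1%:R.
Proof.
move=> n0; apply: le_trans (prime_sum_pow2 _) => //.
have h : (n <= 2 ^ (trunc_log 2 n).+1)%N by apply: ltnW; apply: trunc_log_ltn.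
rewrite -(subnKC h) iotaD big_cat /= lerDl; apply: sumr_ge0 => p _.
by rewrite invr_ge0.
Qed.
End Analytic.

Section Final.
Variable R : realType.
Implicit Types x : R.

Lemma ln2_bounds : 1 / 2 <= ln (2 : R) <= 1.
Proof.
apply/andP; split; last first.
  by have := @le_ln1Dx R 1; rewrite (_ : 1 + 1 = 2) //; apply; lra.
have := @le_ln1Dx R (- (1 / 2)); rewrite (_ : 1 + - (1 / 2) = 2^-1); last lra.
rewrite lnV ?posrE //; move: (ln 2) => a; lra.
Qed.

Lemma ln_le_half x : 0 < x -> ln x <= x / 2.
Proof.
move=> x0; have h1 : -1 < x / 2 - 1 by lra.
have h2 := le_ln1Dx h1; have /andP [_ h3] := ln2_bounds.
have p1 : 0 < 1 + (x / 2 - 1) by lra.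
have -> : ln x = ln (1 + (x / 2 - 1)) + ln 2.
  by rewrite -lnM ?posrE //; congr ln; field.
lra.
Qed.

Lemma trunc_log_le (n : nat) : (0 < n)%N -> (trunc_log 2 n)%:R <= 2 * ln (n%:R : R).
Proof.
move=> n0; have h := trunc_logP (isT : (1 < 2)%N) n0.
have h1 : ln ((2 ^ trunc_log 2 n)%:R : R) <= ln n%:R.
  by rewrite ler_ln ?posrE ?ltr0n ?expn_gt0 // ler_nat.
move: h1; rewrite natrX lnXn // -[_ *+ _]mulr_natr.
have /andP [h2 _] := ln2_bounds.
have : 0 <= (trunc_log 2 n)%:R :> R by [].
move: ((trunc_log 2 n)%:R) (ln n%:R) (ln 2) h2 => a b c; nra.
Qed.

(** Here [p ^ (t - 1) = p ^ t / p] and [p ^ t <= exp (t * l)]. *)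
Lemma prime_expr_nat_sum (t l : R) (Y : nat) : 0 <= t -> (0 < Y)%N -> ln Y%:R <= l ->
  \sum_(p <- iota 1 Y | prime p) expr_nat (- (1 - t)) p <=
  expR (t * l) * \sum_(p <- iota 1 Y | prime p) (p%:R : R)^-1.
Proof.
move=> t0 Y0 hl; rewrite big_distrr /= big_seq_cond [leRHS]big_seq_cond.
apply: ler_sum => p; rewrite mem_iota add1n ltnS => /andP [/andP [p1 pY] _].
have p0 : 0 < p%:R :> R by rewrite ltr0n.
rewrite /expr_nat (_ : - (1 - t) * ln p%:R = t * ln p%:R + - ln p%:R); last by ring.
rewrite expRD expRN lnK ?posrE // ler_wpM2r ?invr_ge0 ?(ltW p0) //.
rewrite ler_expR ler_wpM2l //; apply: le_trans hl.
by rewrite ler_ln ?posrE ?ltr0n // ler_nat.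
Qed.

(** With [X = ln n], [la = ln X] and [y = exp l], [l = sqrt (X la / 2)], apply
    Rankin's inequality at the exponent [1 - t], where [t] is chosen such that
    [y ^ t = sqrt X / la]: then the prime sum is [O(sqrt X)], and
    [t * X = l - O(sqrt X)]. *)
Lemma num_chains_bound (n : nat) : 1 <= ln (ln (n%:R : R)) ->
  (num_chains n)%:R <= 3 * n%:R *
    expR (- (Num.sqrt (ln n%:R * ln (ln n%:R)) / Num.sqrt 2) + 38 * Num.sqrt (ln n%:R)) :> R.
Proof.
set X := ln n%:R; set la := ln X => la1.
have X0 : 0 < X by rewrite ltNge; apply/negP => h; move: la1; rewrite /la ln0 //; lra.
have eX : expR la = X by rewrite lnK ?posrE.
have n0 : (0 < n)%N by rewrite lt0n; apply: contraTneq X0 => n0; rewrite /X n0 ln0 // ltxx.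
have n0' : 0 < n%:R :> R by rewrite ltr0n.
have eh : expR (la / 2) ^+ 2 = X by rewrite -expRM_natl (_ : 2%:R * (la / 2) = la) //; field.
have X2 : 2 * la <= X.
  rewrite -eh; apply: (@le_trans _ _ ((1 + la / 2) ^+ 2)).
    by rewrite -subr_ge0 (_ : _ - _ = (1 - la / 2) ^+ 2) ?sqr_ge0 //; field.
  by rewrite ler_pXn2r ?nnegrE ?expR_ge0 ?expR_ge1Dx //; lra.
set u := Num.sqrt X; set v := Num.sqrt la; set r := Num.sqrt 2.
have la0 : 0 < la by lra.
have u2 : u ^+ 2 = X by rewrite sqr_sqrtr ?ltW.
have v2 : v ^+ 2 = la by rewrite sqr_sqrtr ?ltW.
have r2 : r ^+ 2 = 2 by rewrite sqr_sqrtr.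
have u0 : 0 < u by rewrite sqrtr_gt0.
have v0 : 0 < v by rewrite sqrtr_gt0.
have r0 : 0 < r by rewrite sqrtr_gt0.
have ehu : expR (la / 2) = u by rewrite /u -eh sqrtr_sqr ger0_norm // expR_ge0.
rewrite sqrtrM ?(ltW X0) // -/u -/v; set l := u * v / r.
have l0 : 0 < l by rewrite divr_gt0 ?mulr_gt0.
have rvu : r * v <= u.
  by rewrite -(ler_pXn2r (n:=2)) ?nnegrE ?mulr_ge0 ?(ltW r0) ?(ltW u0) ?(ltW v0) // exprMn r2 v2 u2.
(* exp s = sqrt X / la, and t is the loss 1 - sigma in Rankin's exponent sigma *)
pose s := la / 2 - ln la; pose t := s / l.
have lnla0 : 0 <= ln la by rewrite ln_ge0.
have s0 : 0 <= s by rewrite subr_ge0 ln_le_half.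
have t0 : 0 <= t by rewrite divr_ge0 // ltW.
have t2 : t <= 1 / 2.
  rewrite ler_pdivrMr // /l; apply: (@le_trans _ _ (la / 2)); first by rewrite /s; lra.
  rewrite -v2 mulrA ler_pdivlMr //.
  have := ler_wpM2l (ltW v0) rvu; nra.
have tl : t * l = s by rewrite divfK // gt_eqF.
have es : expR s = u / la by rewrite /s expRD expRN ehu lnK ?posrE.
pose Y := Num.trunc (expR l).
have y1 : 1 <= expR l by rewrite -[leLHS]expR0 ler_expR ltW.
have /andP [Y1 Y2] := truncn_itv (expR_ge0 l); rewrite -/Y in Y1 Y2.
have Y0 : (0 < Y)%N by rewrite truncn_gt0.
have Y0' : 0 < Y%:R :> R by rewrite ltr0n.
have lnY : ln Y%:R <= l by rewrite -(expRK l) ler_ln ?posrE ?expR_gt0.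
have lX : l <= X.
  have h1 : v <= u * r.
    rewrite -(ler_pXn2r (n:=2)) ?nnegrE ?mulr_ge0 ?(ltW r0) ?(ltW u0) ?(ltW v0) // exprMn r2 v2 u2; nra.
  rewrite /l ler_pdivrMr // (_ : X * r = u * (u * r)); last by rewrite mulrA -expr2 u2.
  by rewrite ler_wpM2l ?(ltW u0).
have Yn : (Y <= n)%N.
  rewrite -(ler_nat R); apply: le_trans Y1 _; rewrite -[leRHS]lnK ?posrE //.
  by rewrite ler_expR.
(* 3 + 2 ln (3 X) <= 7 + 2 la, as ln 3 <= 2 *)
have hS : \sum_(p <- iota 1 Y | prime p) (p%:R : R)^-1 <= 9 * la.
  apply: le_trans (prime_sum_le R Y0) _.
  have hK : (trunc_log 2 Y).+1%:R <= 3 * X.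
    apply: (@le_trans _ _ (trunc_log 2 n).+1%:R); first by rewrite ler_nat ltnS leq_trunc_log.
    rewrite -natr1; have := trunc_log_le n0; rewrite -/X; lra.
  have h3 : ln (trunc_log 2 Y).+1%:R <= 2 + la.
    apply: (@le_trans _ _ (ln (3 * X))); first by rewrite ler_ln ?posrE ?ltr0n // mulr_gt0.
    rewrite lnM ?posrE // -/la lerD2r.
    by have := @le_ln1Dx R 2; rewrite (_ : 1 + 2 = 3) //; apply; lra.
  move: (ln _%:R) h3 => a; lra.
have hP : (smooth_count n Y)%:R <= n%:R * expR (- l + 38 * u).
  apply: le_trans (rankin (s := 1 - t) _ Y0 n0) _; first lra.
  have quot_sum := le_trans (prime_expr_nat_sum t0 Y0 lnY) (ler_wpM2l (expR_ge0 _) hS).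
  rewrite tl es (_ : u / la * (9 * la) = 9 * u) in quot_sum; last by field; rewrite gt_eqF.
  rewrite /expr_nat -/X -[n%:R]lnK ?posrE // -/X -!expRD ler_expR.
  (* t X = s sqrt (2 X / la) loses only sqrt (2 X) ln la / sqrt la against l *)
  have htX : l - 2 * u <= t * X.
    have e1 : t * X = r * u * v / 2 - r * u * (ln la / v).
      have -> : t * X = s * r * u / v.
        by rewrite /t /l -u2; field; rewrite !gt_eqF.
      rewrite /s -v2; field; rewrite gt_eqF //.
    have e2 : l = r * u * v / 2.
      by rewrite /l -r2; field; rewrite gt_eqF.
    have h1 : ln la / v <= 1.
      rewrite ler_pdivrMr // mul1r -v2 lnXn // mulr2n.
      have := ln_le_half v0; move: (ln v) => a; lra.
    have hr : r <= 2 by nra.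
    rewrite e1 e2; move: (ln la / v) h1 => a h1.
    have : r * u * a <= r * u * 1 by rewrite ler_wpM2l // mulr_ge0 ?(ltW r0) ?(ltW u0).
    have : r * u <= 2 * u by rewrite ler_wpM2r // ltW.
    move: (r * u * v / 2) (r * u * a) => b c; lra.
  move: (\sum_(_ <- _ | _) _) quot_sum => S quot_sum; lra.
(* the integer part Y of y is at least y / 2 *)
have hD : (n %/ Y)%:R <= 2 * n%:R * expR (- l).
  apply: (@le_trans _ _ (n%:R / Y%:R)).
    by rewrite ler_pdivlMr // -natrM ler_nat leq_trunc_div.
  have h2Y : expR l <= 2 * Y%:R.
    have : 1 <= Y%:R :> R by rewrite ler1n.
    by move: Y2; rewrite -natr1; move: (expR l) (Y%:R) => a b; lra.
  rewrite expRN ler_pdivrMr // mulrAC ler_pdivlMr ?expR_gt0 //.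
  by rewrite -mulrA mulrCA ler_wpM2l // ltW.
have := num_chains_le n Y0; rewrite -(ler_nat R) natrD => h.
apply: (le_trans h); apply: (le_trans (lerD hD hP)).
have h38 : 1 <= expR (38 * u) by rewrite -[leLHS]expR0 ler_expR mulr_ge0 // ltW.
rewrite expRD; have := expR_gt0 (- l); move: (expR (- l)) (expR (38 * u)) h38 => a b hb ha.
have := ler_wpM2l (ltW (mulr_gt0 n0' ha)) hb; nra.
Qed.

Lemma work_bound (n : nat) : 1 <= ln (ln (n%:R : R)) ->
  (nlog n * num_chains n)%:R <= 9 * n%:R ^+ 2 *
    expR (- (Num.sqrt (ln n%:R * ln (ln n%:R)) / Num.sqrt 2) + 40 * Num.sqrt (ln n%:R)) :> R.
Proof.
move=> h; have hN := num_chains_bound h; move: hN h.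
set X := ln n%:R; set la := ln X => hN la1.
have X0 : 0 < X by rewrite ltNge; apply/negP => h; move: la1; rewrite /la ln0 //; lra.
have n0 : (0 < n)%N by rewrite lt0n; apply: contraTneq X0 => n0; rewrite /X n0 ln0 // ltxx.
have n0' : 0 < n%:R :> R by rewrite ltr0n.
have X1 : 1 <= X by have := expR_ge1Dx la; rewrite lnK ?posrE //; lra.
have hL : (nlog n)%:R <= n%:R * (3 * expR (2 * Num.sqrt X)).
  rewrite /nlog natrM ler_wpM2l //; apply: (@le_trans _ _ (3 * X)).
    rewrite -natr1; have := trunc_log_le n0; rewrite -/X; lra.
  rewrite ler_wpM2l // expRM_natl -{1}[X]sqr_sqrtr ?(ltW X0) //.
  rewrite ler_pXn2r ?nnegrE ?sqrtr_ge0 ?expR_ge0 //.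
  have := expR_ge1Dx (Num.sqrt X); lra.
rewrite natrM; apply: (le_trans (ler_pM _ _ hL hN)) => //.
set a := Num.sqrt X; rewrite (_ : - _ + 40 * a = 2 * a + (- (Num.sqrt (X * la) / Num.sqrt 2) + 38 * a)); last by ring.
rewrite [in leRHS]expRD le_eqVlt; apply/orP; left; apply/eqP; ring.
Qed.

(** * The exponent *)

(** [L ^ (1 / sqrt (ln (ln n)))] is [exp (sqrt (ln n))], so this exponent absorbs
    the factor [exp (40 * sqrt (ln n))]. *)
Definition deficit (n : nat) : R := - (40 / Num.sqrt (ln (ln n%:R))).

Lemma lnln_ge (A : R) : exists N : nat, forall n, (N <= n)%N -> A <= ln (ln (n%:R : R)).
Proof.
exists (Num.trunc (expR (expR A))).+1 => n hn.
have h : expR (expR A) <= n%:R.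
  have /andP [_ h] := truncn_itv (expR_ge0 (expR A)).
  by apply: (le_trans (ltW h)); rewrite ler_nat.
have h1 : expR A <= ln n%:R.
  by rewrite -[leLHS]expRK ler_ln ?posrE ?expR_gt0 // (lt_le_trans (expR_gt0 _) h).
by rewrite -[leLHS]expRK ler_ln ?posrE ?expR_gt0 // (lt_le_trans (expR_gt0 _) h1).
Qed.

Lemma deficit_cvg : deficit n @[n --> \oo] --> 0.
Proof.
apply/cvgrPdist_le => e e0.
have [N hN] := lnln_ge ((40 / e) ^+ 2).
exists N => // n /= Nn; rewrite /deficit sub0r opprK ger0_norm; last first.
  by rewrite divr_ge0 ?sqrtr_ge0.
have h : 40 / e <= Num.sqrt (ln (ln n%:R)).
  rewrite -[leLHS]ger0_norm ?divr_ge0 ?(ltW e0) // -sqrtr_sqr ler_sqrt; first exact: hN.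
  by apply: le_trans (hN n Nn); rewrite sqr_ge0.
have s0 : 0 < Num.sqrt (ln (ln (n%:R : R))) by apply: lt_le_trans h; rewrite divr_gt0.
by rewrite ler_pdivrMr // mulrC -ler_pdivrMr.
Qed.

Lemma target_powR (n : nat) : 1 <= ln (ln (n%:R : R)) ->
  n%:R ^+ 2 / L R n `^ ((Num.sqrt 2)^-1 + deficit n) =
  n%:R ^+ 2 * expR (- (Num.sqrt (ln n%:R * ln (ln n%:R)) / Num.sqrt 2) + 40 * Num.sqrt (ln n%:R)).
Proof.
move=> h; congr (_ * _); rewrite /L /powR gt_eqF ?expR_gt0 // expRK -expRN; congr expR.
have X0 : 0 < ln (n%:R : R) by rewrite ltNge; apply/negP => h'; move: h; rewrite ln0 //; lra.
have v0 : 0 < Num.sqrt (ln (ln (n%:R : R))) by rewrite sqrtr_gt0; lra.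
have r0 : 0 < Num.sqrt (2 : R) by rewrite sqrtr_gt0.
rewrite /deficit sqrtrM ?(ltW X0) //; field; rewrite !gt_eqF //.
Qed.
End Final.

Theorem theorem2p9 (R : realType) :
  exists (c : nat) (P : cmd) (T : nat -> nat) (eps : nat -> R),
    [/\ (0 < c)%N,
        forall n : nat, (0 < n)%N -> tabulates c P n (T n),
        eps n @[n --> \oo] --> 0 &
        (fun n : nat => (T n)%:R : R) =O_\oo
          (fun n : nat => n%:R ^+ 2 / L R n `^ ((Num.sqrt 2)^-1 + eps n))].
Proof.
have [C hC] := tabulates_tabulate.
have /choice [T hT] (n : nat) : exists t : nat, (0 < n)%N ->
    tabulates 10 tabulate n t /\ (t <= C * (nlog n * num_chains n))%N.
  case: (posnP n) => [->|n0]; first by exists 0%N.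
  by have [t h1 h2] := hC n n0; exists t.
exists 10%N, tabulate, T, (@deficit R); split=> //.
- by move=> n /hT [].
- exact: deficit_cvg.
apply/eqOP; exists (C%:R * 9); split; first exact: num_real.
move=> k /ltW hk.
have [N hN] := lnln_ge (1 : R).
exists N => // n /= Nn; have h := hN n Nn.
have n0 : (0 < n)%N.
  by rewrite lt0n; apply: contraTneq h => ->; rewrite !ln0 // ler10.
have [_ hTn] := hT n n0.
rewrite target_powR // !ger0_norm ?mulr_ge0 ?expR_ge0 ?exprn_ge0 //.
set G := _ ^+ 2 * _; have G0 : 0 <= G by rewrite mulr_ge0 ?expR_ge0 ?exprn_ge0.
apply: (@le_trans _ _ (C%:R * (nlog n * num_chains n)%:R)); first by rewrite -natrM ler_nat.
apply: (@le_trans _ _ (C%:R * (9 * G))); last by rewrite mulrA ler_wpM2r.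
by rewrite ler_wpM2l //; have := work_bound h; rewrite -mulrA.
Qed.
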